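(* For every positive integer $p$ and every nonnegative integer $n$, the sum $J_p=\sum_{k=1}^{p-1}k\cot\left(\frac{k\pi}{p}\right)$ satisfies $$J_p<\frac1\pi\left(-p^2\ln p+(\ln(2\pi)-\gamma)p^2-p\right)+2\pi\sum_{k=1}^{2n}(-1)^k\frac{b_{2k}^2}{k\cdot(2k)!}\left(\frac{2\pi}{p}\right)^{2k-2}$$ and $$J_p>\frac1\pi\left(-p^2\ln p+(\ln(2\pi)-\gamma)p^2-p\right)+2\pi\sum_{k=1}^{2n+1}(-1)^k\frac{b_{2k}^2}{k\cdot(2k)!}\left(\frac{2\pi}{p}\right)^{2k-2}.$$
   Context: The Bernoulli polynomials $(B_n)_{n\ge 0}$ are the unique sequence of real polynomials with $B_0(X)=1$ and, for all $n\ge1$, $B_n(X+1)-B_n(X)=nX^{n-1}$ and $\int_0^1B_n(t)\,dt=0$; the Bernoulli numbers are $b_n=B_n(0)$. $\gamma$ is the Euler–Mascheroni constant. Empty sums are $0$ (so $J_1=0$). *)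

(* Defs.v *)
From Stdlib Require Import Reals Factorial Lra Lia.
From Coquelicot Require Import Coquelicot.
Open Scope R_scope.

(* Real polynomials are identified with their polynomial functions, which is
   harmless over the infinite field R. *)
Definition is_polynomial (f : R -> R) : Prop :=
  exists (a : nat -> R) (d : nat),
    forall x, f x = sum_n (fun k => a k * x ^ k) d.

Definition bernoulli_polynomials (B : nat -> R -> R) : Prop :=
  (forall n, is_polynomial (B n)) /\
  (forall x, B 0%nat x = 1) /\
  (forall n, (1 <= n)%nat ->
     (forall x, B n (x + 1) - B n x = INR n * x ^ (n - 1)) /\
     is_RInt (B n) 0 1 0).

Definition bernoulli_number (B : nat -> R -> R) (n : nat) : R := B n 0.

(* The term of index 0 involves the junk value [ln 0]; it does not affect the
   limit. *)
Definition euler_gamma : R :=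
  real (Lim_seq (fun n => sum_n_m (fun k => / INR k) 1 n - ln (INR n))).

Definition cot (x : R) : R := cos x / sin x.

(* [sum_n_m a i j] is the sum of [a k] over [i <= k <= j], and [0] if [j < i]. *)
Definition cot_sum (p : nat) : R :=
  sum_n_m (fun k => INR k * cot (INR k * PI / INR p)) 1 (p - 1).

(* The natural-number subtraction [2 * k - 2] is exact, since the sum starts at
   [k = 1]. *)
Definition cot_sum_approx (B : nat -> R -> R) (p m : nat) : R :=
  / PI * (- INR p ^ 2 * ln (INR p)
          + (ln (2 * PI) - euler_gamma) * INR p ^ 2 - INR p)
  + 2 * PI *
    sum_n_m (fun k => (-1) ^ k
                      * (bernoulli_number B (2 * k) ^ 2
                         / (INR k * INR (fact (2 * k))))
                      * (2 * PI / INR p) ^ (2 * k - 2)) 1 m.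

(* Coquelicot often leaves goals at the carrier of a canonical structure, where
   [ring] does not recognize [R]. *)
Local Ltac Rring :=
  repeat match goal with
  | |- context [match ?k with O => 1 | S _ => INR ?k + 1 end] =>
      change (match k with O => 1 | S _ => INR k + 1 end) with (INR (S k))
  end;
  apply Rminus_diag_uniq; ring.

Lemma polynomial_primitive f : is_polynomial f ->
  exists F, is_polynomial F /\ forall x, is_derive F x (f x).
Proof.
intros [a [d Hf]].
exists (fun x => sum_n (fun k => match k with O => 0 | S j => a j / INR (S j) end
                                 * x ^ k) (S d)).
split.
- now exists (fun k => match k with O => 0 | S j => a j / INR (S j) end), (S d).
- intros x; rewrite Hf.
  apply is_derive_ext with (fun x => sum_n (fun k => a k / INR (S k) * x ^ (S k)) d).
  + intros t; unfold sum_n.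
    rewrite (sum_Sn_m _ 0 (S d)), <- sum_n_m_S by lia.
    unfold plus, scal, mult; simpl; Rring.
  + apply (is_derive_sum_n (fun k x => a k / INR (S k) * x ^ S k)).
    intros k _.
    assert (H : INR (S k) <> 0) by (apply not_0_INR; lia).
    auto_derive; [trivial|].
    change (match k with O => 1 | S _ => INR k + 1 end) with (INR (S k)).
    simpl pred; apply Rminus_diag_uniq; field; exact H.
Qed.

Lemma polynomial_affine f c e :
  is_polynomial f -> is_polynomial (fun x => c * f x + e).
Proof.
intros [a [d Hf]].
exists (fun k => match k with O => c * a O + e | S _ => c * a k end), d.
intros x; rewrite Hf; clear Hf.
induction d as [|d IH].
- rewrite !sum_O; simpl; Rring.
- rewrite !sum_Sn; unfold plus in *; simpl in *; rewrite <- IH; Rring.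
Qed.

Lemma polynomial_continuous f x : is_polynomial f -> continuous f x.
Proof.
intros [a [d Hf]].
apply continuous_ext with (1 := fun y => eq_sym (Hf y)).
apply (@ex_derive_continuous R_AbsRing R_NormedModule).
eexists; apply (is_derive_sum_n (fun k x => a k * x ^ k)).
intros k _; auto_derive; [trivial|reflexivity].
Qed.

Lemma polynomial_is_RInt f F a b :
  is_polynomial f -> (forall x, is_derive F x (f x)) ->
  is_RInt f a b (F b - F a).
Proof.
intros Hf HF.
apply (is_RInt_derive F f); intros; auto using polynomial_continuous.
Qed.

Fixpoint bernoulli_poly (n : nat) : R -> R :=
  match n with
  | O => fun _ => 1
  | S m =>
    let F x := RInt (bernoulli_poly m) 0 x in
    fun x => INR (S m) * (F x - RInt F 0 1)
  end.

Lemma constant_of_derive0 f a b :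
  (forall x, is_derive f x 0) -> f a = f b.
Proof.
intros H.
destruct (MVT_gen f a b (fun _ => 0)) as [c [_ Hc]]; auto; [|lra].
intros x _; apply continuity_pt_filterlim.
apply (@ex_derive_continuous R_AbsRing R_NormedModule); now exists 0.
Qed.

Lemma bernoulli_poly_step n : is_polynomial (bernoulli_poly n) ->
  is_polynomial (bernoulli_poly (S n)) /\
  is_RInt (bernoulli_poly (S n)) 0 1 0 /\
  (forall x, is_derive (bernoulli_poly (S n)) x (INR (S n) * bernoulli_poly n x)).
Proof.
intros Hn.
destruct (polynomial_primitive _ Hn) as [F [HF HdF]].
assert (HR : forall x, RInt (bernoulli_poly n) 0 x = F x - F 0).
{ intros x; apply is_RInt_unique, polynomial_is_RInt; auto. }
set (I := RInt (fun x => RInt (bernoulli_poly n) 0 x) 0 1).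
assert (HE : forall x, bernoulli_poly (S n) x
                       = INR (S n) * F x + INR (S n) * (- F 0 - I)).
{ intros x; change (bernoulli_poly (S n) x)
    with (INR (S n) * (RInt (bernoulli_poly n) 0 x - I)).
  rewrite HR; Rring. }
split; [|split].
- destruct (polynomial_affine F (INR (S n)) (INR (S n) * (- F 0 - I)) HF)
    as [a [d H]].
  exists a, d; intros x; rewrite HE; apply H.
- assert (HI : is_RInt (fun x => RInt (bernoulli_poly n) 0 x) 0 1 I).
  { apply (@RInt_correct R_CompleteNormedModule).
    apply ex_RInt_ext with (fun x => 1 * F x + (- F 0)).
    - intros x _; rewrite HR; Rring.
    - apply (@ex_RInt_continuous R_CompleteNormedModule).
      intros z _; apply polynomial_continuous, polynomial_affine, HF. }
  replace 0 with (INR (S n) * (I - (1 - 0) * I)) at 2 by Rring.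
  apply (is_RInt_scal (V := R_NormedModule)
           (fun x => RInt (bernoulli_poly n) 0 x - I) 0 1 (INR (S n))).
  apply (is_RInt_minus (V := R_NormedModule)
           (fun x => RInt (bernoulli_poly n) 0 x) (fun _ => I)); [exact HI|].
  apply (is_RInt_const (V := R_NormedModule)).
- intros x.
  apply is_derive_ext with (1 := fun y => eq_sym (HE y)).
  auto_derive; [now eexists; apply HdF|].
  rewrite (is_derive_unique (fun x : R => F x) _ _ (HdF x)); Rring.
Qed.

Lemma is_derive_difference (f f' : R -> R) c m :
  (forall x, is_derive f x (f' x)) ->
  forall y, is_derive (fun y => f (y + 1) - f y - c * y ^ m) y
              (f' (y + 1) - f' y - c * (INR m * y ^ pred m)).
Proof.
intros Hd y.
auto_derive; [repeat split; eexists; apply Hd|].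
rewrite (is_derive_unique (fun x : R => f x) _ _ (Hd (y + 1))).
rewrite (is_derive_unique (fun x : R => f x) _ _ (Hd y)).
Rring.
Qed.

Lemma bernoulli_poly_spec : bernoulli_polynomials bernoulli_poly.
Proof.
assert (Hpol : forall n, is_polynomial (bernoulli_poly n)).
{ intros n; induction n as [|n IH]; [|now apply bernoulli_poly_step].
  exists (fun _ => 1), O; intros x; rewrite sum_O; simpl; Rring. }
split; [exact Hpol|]; split; [reflexivity|].
intros [|n] Hn; [lia|]; clear Hn.
destruct (bernoulli_poly_step n (Hpol n)) as [_ [HI _]].
split; [|exact HI]; clear HI.
replace (S n - 1)%nat with n by lia.
induction n as [|n IH]; intros x;
  match goal with |- bernoulli_poly (S ?m) _ - _ = _ =>
    destruct (bernoulli_poly_step m (Hpol m)) as [_ [_ Hd]];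
    pose (g := fun y => bernoulli_poly (S m) (y + 1) - bernoulli_poly (S m) y
                        - INR (S m) * y ^ m)
  end.
- assert (H : g x = g 0).
  { apply constant_of_derive0; intros y; unfold g.
    evar_last; [apply (is_derive_difference _ _ _ 0 Hd)|].
    simpl; Rring. }
  assert (H1 : is_RInt (bernoulli_poly 0) 0 1
                 (bernoulli_poly 1 1 - bernoulli_poly 1 0)).
  { apply polynomial_is_RInt; [apply Hpol|].
    intros y; evar_last; [apply Hd|simpl; Rring]. }
  apply (@is_RInt_unique R_CompleteNormedModule) in H1.
  assert (H0 : RInt (bernoulli_poly 0) 0 1 = 1).
  { apply is_RInt_unique; evar_last;
      [apply (is_RInt_const (V := R_NormedModule))|].
    unfold scal; simpl; unfold mult; simpl; Rring. }
  rewrite H0 in H1; unfold g in H; rewrite Rplus_0_l, <- H1 in H.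
  apply Rminus_diag_uniq; rewrite H; simpl; Rring.
- assert (H : g x = g 0).
  { apply constant_of_derive0; intros y; unfold g.
    evar_last; [apply (is_derive_difference _ _ _ (S n) Hd)|].
    pose proof (IH y) as IHy; unfold pred.
    transitivity (INR (S (S n)) * (bernoulli_poly (S n) (y + 1)
                  - bernoulli_poly (S n) y - INR (S n) * y ^ n)); [Rring|].
    rewrite IHy; Rring. }
  assert (H1 : is_RInt (fun x => INR (S (S n)) * bernoulli_poly (S n) x) 0 1
                 (bernoulli_poly (S (S n)) 1 - bernoulli_poly (S (S n)) 0)).
  { apply (is_RInt_derive (bernoulli_poly (S (S n)))); [intros; apply Hd|].
    intros z _.
    apply continuous_ext with (fun x => INR (S (S n)) * bernoulli_poly (S n) x + 0);
      [intros; Rring|].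
    apply polynomial_continuous, polynomial_affine, Hpol. }
  assert (H0 : is_RInt (fun x => INR (S (S n)) * bernoulli_poly (S n) x) 0 1
                 (INR (S (S n)) * 0)).
  { apply (is_RInt_scal (V := R_NormedModule)).
    now apply bernoulli_poly_step. }
  apply (@is_RInt_unique R_CompleteNormedModule) in H1.
  apply (@is_RInt_unique R_CompleteNormedModule) in H0.
  rewrite H0 in H1; unfold g in H; rewrite Rplus_0_l, <- H1, pow_i in H by lia.
  apply Rminus_diag_uniq; rewrite H; Rring.
Qed.

Lemma periodic_polynomial_constant d : forall (a : nat -> R) (f : R -> R),
  (forall x, f x = sum_n (fun k => a k * x ^ k) d) ->
  (forall x, f (x + 1) = f x) -> forall x, f x = f 0.
Proof.
induction d as [|d IH]; intros a f Hf Hper x.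
- rewrite !Hf, !sum_O; simpl; Rring.
- pose (g := fun x => sum_n (fun k => (INR (S k) * a (S k)) * x ^ k) d).
  assert (Hd : forall x, is_derive f x (g x)).
  { intros y.
    apply is_derive_ext with
      (fun x => a O + sum_n (fun k => a (S k) * x ^ (S k)) d).
    - intros t; rewrite Hf; unfold sum_n.
      rewrite (sum_Sn_m _ 0 (S d)), <- sum_n_m_S by lia.
      unfold plus, scal, mult; simpl; Rring.
    - evar_last.
      + apply (is_derive_plus (V := R_NormedModule)); [apply (is_derive_const (V := R_NormedModule))|].
        apply (is_derive_sum_n (fun k x => a (S k) * x ^ (S k)) d y
                 (fun k => (INR (S k) * a (S k)) * y ^ k)).
        intros k _; auto_derive; [trivial|].
        change (match k with O => 1 | S _ => INR k + 1 end) with (INR (S k)).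
        simpl pred; Rring.
      + unfold plus, zero; simpl; unfold g; apply Rplus_0_l. }
  assert (Hg : forall x, g x = g 0).
  { apply (IH (fun k => INR (S k) * a (S k))); [reflexivity|].
    intros y.
    rewrite <- (is_derive_unique f y (g y)) by apply Hd.
    symmetry; apply is_derive_unique.
    apply is_derive_ext with (fun x => f (x + 1)); [exact Hper|].
    auto_derive; [eexists; apply Hd|].
    rewrite (is_derive_unique (fun x : R => f x) _ _ (Hd (y + 1))); Rring. }
  assert (Hl : forall u v, f u - g 0 * u = f v - g 0 * v).
  { intros u v.
    apply (constant_of_derive0 (fun t => f t - g 0 * t)); intros y.
    auto_derive; [eexists; apply Hd|].
    rewrite (is_derive_unique (fun x : R => f x) _ _ (Hd y)), Hg; Rring. }
  pose proof (Hl 1 0) as H1; pose proof (Hper 0) as H2.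
  rewrite Rplus_0_l in H2.
  assert (H3 : g 0 = 0) by lra.
  specialize (Hl x 0); rewrite H3 in Hl; lra.
Qed.

Lemma polynomial_minus f g : is_polynomial f -> is_polynomial g ->
  is_polynomial (fun x => f x - g x).
Proof.
intros [a [d Hf]] [b [e Hg]].
assert (ext : forall (c : nat -> R) (m l : nat) x,
  sum_n (fun k => (if Nat.leb k m then c k else 0) * x ^ k) (m + l)
  = sum_n (fun k => c k * x ^ k) m).
{ intros c m l x; induction l as [|l IH].
  - rewrite Nat.add_0_r; apply sum_n_ext_loc; intros k Hk.
    now rewrite (proj2 (Nat.leb_le k m) Hk).
  - rewrite Nat.add_succ_r, sum_Sn, IH.
    rewrite (proj2 (Nat.leb_gt (S (m + l)) m)) by lia.
    unfold plus, scal, mult; simpl; Rring. }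
exists (fun k => (if Nat.leb k d then a k else 0) - (if Nat.leb k e then b k else 0)),
  (d + e)%nat.
intros x; rewrite Hf, Hg, <- (ext a d e x), <- (ext b e d x), (Nat.add_comm e d).
generalize (d + e)%nat as m; induction m as [|m IH].
- rewrite !sum_O; Rring.
- rewrite !sum_Sn; unfold plus in *; simpl in *; lra.
Qed.

Lemma bernoulli_polynomials_unique B C :
  bernoulli_polynomials B -> bernoulli_polynomials C ->
  forall n x, B n x = C n x.
Proof.
intros [HB [HB0 HB1]] [HC [HC0 HC1]] [|n] x; [now rewrite HB0, HC0|].
destruct (HB1 (S n)) as [dB iB]; [lia|].
destruct (HC1 (S n)) as [dC iC]; [lia|].
destruct (polynomial_minus _ _ (HB (S n)) (HC (S n))) as [a [d H]].
pose proof (periodic_polynomial_constant d a _ H) as Hc; cbv beta in Hc.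
specialize (Hc (fun y => ltac:(specialize (dB y); specialize (dC y); lra))).
pose proof (is_RInt_minus (V := R_NormedModule) _ _ _ _ _ _ iB iC) as Hi.
apply (is_RInt_ext (V := R_NormedModule) _ (fun _ => B (S n) 0 - C (S n) 0)) in Hi;
  [|now intros y _; apply Hc].
apply (@is_RInt_unique R_CompleteNormedModule) in Hi.
rewrite RInt_const in Hi.
unfold scal, minus, plus, opp in Hi; simpl in Hi; unfold mult in Hi; simpl in Hi.
specialize (Hc x); lra.
Qed.

(* Main.v *)
Require Import Defs.
From Stdlib Require Import Reals.
From Coquelicot Require Import Coquelicot.
From Stdlib Require Import Lra Lia Factorial.
Open Scope R_scope.

(** Expanding [k/p - 1/2] in its Fourier series and summing over [k] against the
    cotangents turns [pi J_p / p] into the limit of a combination of the harmonic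
    numbers [H_{mp}], [m <= N].  By Stirling's formula the elementary part of
    [H_x = ln x + gamma + 1/(2x) + e_x] produces the main term, so that
    [J_p] equals it plus [(2 p^2 / pi) * sum_m e_{mp}].  The asymptotic
    expansion [- sum_k b_{2k} / (2k x^{2k})] of [e_x] is enveloping, because
    [(-1)^k (B_{2k} - b_{2k})] is positive on (0,1); summing it over [x = mp]
    introduces the zeta values at [2k], which are multiples of [b_{2k}] and
    account for the squares [b_{2k}^2].  Both the sign and the zeta values come
    from the Fourier series of the Bernoulli polynomials. *)

(** Harmonic numbers appear because the sum over [k] of [sin (2 pi m k / p) cot (k pi / p)] is a
    sawtooth in [m]: it has period [p], vanishes at the multiples of [p] and equals [p - 2i] at
    [m = i] for [0 < i < p]. Divided by [m], it is on each period a multiple of [1/m] minus the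
    constant 2, and summation by parts over the periods leaves the [H_{mp}]. Stopping the Fourier
    series at a multiple of [p] keeps the periods whole.

    The obstacle on the Fourier side is order 1, where convergence is neither absolute nor uniform
    up to the endpoints; the Dirichlet kernel handles it pointwise inside (0,1). From order 2 on, a
    tail bound independent of [t] turns pointwise convergence into a uniform bound, which the mean
    value theorem carries to all higher orders.

    Every series is handled as a limit of partial sums. Limits preserve only weak inequalities, so
    strictness is recovered each time from one term, or one step of a monotone sequence, set apart
    before the limit. *)

(** * Finite sums starting at 1 and mean value estimates *)

Definition sum1 (f : nat -> R) (n : nat) : R := sum_n_m f 1 n.

Lemma sum1_0 (f : nat -> R) : sum1 f 0 = 0.
Proof. apply (sum_n_m_zero (G := R_AbelianMonoid)); lia. Qed.

Lemma sum1_S (f : nat -> R) n : sum1 f (S n) = sum1 f n + f (S n).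
Proof. apply (sum_n_Sm (G := R_AbelianMonoid)); lia. Qed.

Lemma sum1_ext (f g : nat -> R) n :
  (forall k, (1 <= k <= n)%nat -> f k = g k) -> sum1 f n = sum1 g n.
Proof. intros H; apply sum_n_m_ext_loc; exact H. Qed.

Lemma sum1_plus (f g : nat -> R) n :
  sum1 (fun k => f k + g k) n = sum1 f n + sum1 g n.
Proof. exact (sum_n_m_plus (G := R_AbelianMonoid) f g 1 n). Qed.

Lemma sum1_scal (c : R) (f : nat -> R) n :
  sum1 (fun k => c * f k) n = c * sum1 f n.
Proof. exact (sum_n_m_mult_l (K := R_Ring) c f 1 n). Qed.

Lemma sum1_const (c : R) n : sum1 (fun _ => c) n = INR n * c.
Proof.
induction n as [|n IH]; [rewrite sum1_0; simpl; ring|].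
rewrite sum1_S, IH, S_INR; ring.
Qed.

Lemma sum1_first (f : nat -> R) n :
  sum1 f (S n) = f 1%nat + sum1 (fun k => f (S k)) n.
Proof.
induction n as [|n IH]; [rewrite sum1_S, !sum1_0; ring|].
rewrite sum1_S, IH, sum1_S; ring.
Qed.

Lemma sum1_le (f g : nat -> R) n :
  (forall k, (1 <= k <= n)%nat -> f k <= g k) -> sum1 f n <= sum1 g n.
Proof.
induction n as [|n IH]; intros H; [rewrite !sum1_0; lra|].
rewrite !sum1_S; apply Rplus_le_compat; [apply IH; intros; apply H|apply H]; lia.
Qed.

Lemma sum1_rev (f : nat -> R) n : sum1 (fun k => f (S n - k)%nat) n = sum1 f n.
Proof.
revert f; induction n as [|n IH]; intros f; [now rewrite !sum1_0|].
rewrite sum1_S, sum1_first, <- (IH (fun k => f (S k))), Rplus_comm.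
f_equal; [f_equal; lia|].
apply sum1_ext; intros k Hk; f_equal; lia.
Qed.

Lemma is_lim_seq_sum1 (u : nat -> nat -> R) (l : nat -> R) n :
  (forall k, (1 <= k <= n)%nat -> is_lim_seq (u k) (l k)) ->
  is_lim_seq (fun N => sum1 (fun k => u k N) n) (sum1 l n).
Proof.
induction n as [|n IH]; intros H.
- rewrite sum1_0; apply is_lim_seq_ext with (fun _ => 0);
    [intros; now rewrite sum1_0|apply is_lim_seq_const].
- rewrite sum1_S; apply is_lim_seq_ext with
    (fun N => sum1 (fun k => u k N) n + u (S n) N);
    [intros; now rewrite sum1_S|].
  apply is_lim_seq_plus'; [apply IH; intros; apply H|apply H]; lia.
Qed.

Lemma sum1_swap (f : nat -> nat -> R) n m :
  sum1 (fun i => sum1 (fun j => f i j) m) n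
  = sum1 (fun j => sum1 (fun i => f i j) n) m.
Proof.
induction m as [|m IH].
- rewrite sum1_0, (sum1_ext _ (fun _ => 0)), sum1_const; [ring|].
  intros; apply sum1_0.
- rewrite sum1_S, <- IH, <- sum1_plus.
  apply sum1_ext; intros; apply sum1_S.
Qed.

Lemma is_derive_sum1 (f df : nat -> R -> R) n x :
  (forall k, (1 <= k <= n)%nat -> is_derive (f k) x (df k x)) ->
  is_derive (fun y => sum1 (fun k => f k y) n) x
    (sum1 (fun k => df k x) n).
Proof.
induction n as [|n IH]; intros H.
- rewrite sum1_0; apply is_derive_ext with (fun _ => 0);
    [intros; now rewrite sum1_0|apply (is_derive_const (V := R_NormedModule))].
- rewrite sum1_S; apply is_derive_ext with
    (fun y => sum1 (fun k => f k y) n + f (S n) y);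
    [intros; now rewrite sum1_S|].
  apply (is_derive_plus (V := R_NormedModule));
    [apply IH; intros; apply H|apply H]; lia.
Qed.

Lemma MVT_derive (f df : R -> R) a b : a < b ->
  (forall x, a <= x <= b -> is_derive f x (df x)) ->
  exists c, a < c < b /\ f b - f a = df c * (b - a).
Proof.
intros Hab Hd.
destruct (MVT_cor2 f df a b Hab) as [c [Hc1 Hc2]].
- intros c Hc; apply is_derive_Reals, Hd, Hc.
- now exists c.
Qed.

(** The endpoints are unordered because the anchor point [a], later 1/2 or a zero given by Rolle,
    may lie on either side of [b]. *)
Lemma derive_bound (f df : R -> R) (a b C : R) :
  (forall x, Rmin a b <= x <= Rmax a b -> is_derive f x (df x)) ->
  (forall x, Rmin a b <= x <= Rmax a b -> Rabs (df x) <= C) ->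
  Rabs (f b - f a) <= C * Rabs (b - a).
Proof.
intros Hd HC.
destruct (MVT_gen f a b df) as [c [Hc ->]].
- intros x Hx; apply Hd; lra.
- intros x Hx; apply continuity_pt_filterlim.
  apply (@ex_derive_continuous R_AbsRing R_NormedModule).
  eexists; apply Hd, Hx.
- rewrite Rabs_mult; apply Rmult_le_compat_r; [apply Rabs_pos|now apply HC].
Qed.

(** * Elementary properties of the Bernoulli polynomials *)

Lemma bernoulli_poly_polynomial n : is_polynomial (bernoulli_poly n).
Proof. exact (proj1 bernoulli_poly_spec n). Qed.

Lemma bernoulli_poly_derive n x :
  is_derive (bernoulli_poly (S n)) x (INR (S n) * bernoulli_poly n x).
Proof. now apply bernoulli_poly_step, bernoulli_poly_polynomial. Qed.

Lemma bernoulli_poly_periodic n :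
  bernoulli_poly (S (S n)) 1 = bernoulli_poly (S (S n)) 0.
Proof.
destruct (proj2 (proj2 bernoulli_poly_spec) (S (S n))) as [H _]; [lia|].
specialize (H 0); rewrite Rplus_0_l, pow_i in H by lia; lra.
Qed.

(** The derivative leaves a constant [c] free; it is fixed by [B_2(0) = B_2(1)], since
    [B_2 - x^2 - 2cx] is constant. *)
Lemma bernoulli_poly_1 t : bernoulli_poly 1 t = t - 1 / 2.
Proof.
set (c := bernoulli_poly 1 0).
assert (H : forall x, bernoulli_poly 1 x = x + c).
{ intros x.
  assert (E : bernoulli_poly 1 x - x = bernoulli_poly 1 0 - 0).
  { apply (constant_of_derive0 (fun x => bernoulli_poly 1 x - x)); intros y.
    evar_last; [apply (is_derive_minus (V := R_NormedModule));
      [apply bernoulli_poly_derive|apply (is_derive_id (K := R_AbsRing))]|].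
    cbn; unfold minus, plus, opp, one; simpl; ring. }
  unfold c; lra. }
assert (E : bernoulli_poly 2 1 - (1 * 1 + 2 * c * 1)
            = bernoulli_poly 2 0 - (0 * 0 + 2 * c * 0)).
{ apply (constant_of_derive0 (fun x => bernoulli_poly 2 x - (x * x + 2 * c * x))).
  intros y; evar_last; [apply (is_derive_minus (V := R_NormedModule));
      [apply bernoulli_poly_derive|auto_derive; [trivial|reflexivity]]|].
  rewrite H; unfold minus, plus, opp; simpl; ring. }
rewrite (bernoulli_poly_periodic 0) in E; rewrite H; lra.
Qed.

(** * Fourier series of the Bernoulli polynomials *)

Lemma dirichlet_kernel t M :
  (1 + 2 * sum1 (fun m => cos (2 * PI * INR m * t)) M) * sin (PI * t)
  = sin (INR (2 * M + 1) * (PI * t)).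
Proof.
induction M as [|M IH].
- rewrite sum1_0; simpl; rewrite !Rmult_0_r, Rplus_0_r, !Rmult_1_l; reflexivity.
- rewrite sum1_S.
  replace (INR (2 * S M + 1) * (PI * t))
    with (2 * PI * INR (S M) * t + PI * t)
    by (rewrite plus_INR, mult_INR; simpl (INR 2); simpl (INR 1); ring).
  replace (INR (2 * M + 1) * (PI * t))
    with (2 * PI * INR (S M) * t - PI * t) in IH
    by (rewrite plus_INR, mult_INR, S_INR; simpl (INR 2); simpl (INR 1); ring).
  rewrite sin_minus in IH; rewrite sin_plus; lra.
Qed.

(** Remainder of the Fourier series of [B_n] cut at [M], scaled. The phase [n pi / 2] merges sines
    and cosines, so that differentiation only lowers [n] and multiplies by [2 pi]. For [n = 0] this
    is half the Dirichlet kernel. *)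
Definition fourier_rem (n M : nat) (t : R) : R :=
  sum1 (fun m => cos (2 * PI * INR m * t - INR n * (PI / 2)) / INR m ^ n) M
  + (2 * PI) ^ n / (2 * INR (fact n)) * bernoulli_poly n t.

Lemma fourier_rem_derive n M t :
  is_derive (fourier_rem (S n) M) t (2 * PI * fourier_rem n M t).
Proof.
unfold fourier_rem.
evar_last.
- apply (is_derive_plus (V := R_NormedModule)).
  + apply (is_derive_sum1
      (fun m t => cos (2 * PI * INR m * t - INR (S n) * (PI / 2)) / INR m ^ S n)
      (fun m t => 2 * PI * (cos (2 * PI * INR m * t - INR n * (PI / 2)) / INR m ^ n))).
    intros m Hm.
    assert (H : INR m <> 0) by (apply not_0_INR; lia).
    rewrite S_INR.
    replace (INR n * (PI / 2)) with ((INR n + 1) * (PI / 2) - PI / 2) by ring.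
    set (a := (INR n + 1) * (PI / 2)).
    replace (2 * PI * INR m * t - (a - PI / 2))
      with (PI / 2 + (2 * PI * INR m * t - a)) by ring.
    replace (cos (PI / 2 + (2 * PI * INR m * t - a)))
      with (- sin (2 * PI * INR m * t - a)) by (rewrite sin_cos; ring).
    evar_last; [auto_derive; [trivial|reflexivity]|].
    simpl; unfold Rminus; field; split; [now apply pow_nonzero|exact H].
  + apply is_derive_scal, bernoulli_poly_derive.
- rewrite sum1_scal.
  unfold plus; simpl plus; cbn -[fact INR bernoulli_poly sum1 pow].
  rewrite fact_simpl, mult_INR; simpl pow.
  assert (H := INR_fact_neq_0 n).
  assert (H' : INR (S n) <> 0) by (apply not_0_INR; lia).
  field; auto.
Qed.

Lemma fourier_rem_periodic n M :
  fourier_rem (S (S n)) M 1 = fourier_rem (S (S n)) M 0.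
Proof.
unfold fourier_rem; rewrite bernoulli_poly_periodic; f_equal.
apply sum1_ext; intros m _; f_equal.
rewrite <- (cos_period (2 * PI * INR m * 0 - _) m); f_equal; ring.
Qed.

(** Rolle's theorem for the remainder of the next order, which takes equal values at 0 and 1. The
    zero replaces the unknown constant of integration when passing from one order to the next. *)
Lemma fourier_rem_zero n M : exists c, 0 < c < 1 /\ fourier_rem (S n) M c = 0.
Proof.
destruct (MVT_derive (fourier_rem (S (S n)) M)
            (fun t => 2 * PI * fourier_rem (S n) M t) 0 1) as [c [Hc E]];
  [lra|intros; apply fourier_rem_derive|].
exists c; split; [exact Hc|].
rewrite fourier_rem_periodic in E; pose proof PI_RGT_0.
apply Rmult_eq_reg_l with (2 * PI); lra.
Qed.

Lemma fourier_rem_1_derive M t : sin (PI * t) <> 0 ->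
  is_derive (fourier_rem 1 M) t (PI * sin (INR (2 * M + 1) * (PI * t)) / sin (PI * t)).
Proof.
intros Ht; evar_last; [apply fourier_rem_derive|].
rewrite <- dirichlet_kernel; unfold fourier_rem.
rewrite (sum1_ext _ (fun m => cos (2 * PI * INR m * t))).
- simpl; field; exact Ht.
- intros m _; simpl; rewrite Rmult_0_l, Rminus_0_r; field.
Qed.

Lemma fourier_rem_1_half M : fourier_rem 1 M (1 / 2) = 0.
Proof.
unfold fourier_rem; rewrite bernoulli_poly_1, Rminus_diag, Rmult_0_r, Rplus_0_r.
rewrite (sum1_ext _ (fun _ => 0)); [rewrite sum1_const; ring|].
intros m _; simpl (INR 1).
replace (2 * PI * INR m * (1 / 2) - 1 * (PI / 2)) with (- (PI / 2 - INR m * PI))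
  by field.
rewrite cos_neg, cos_shift.
rewrite sin_eq_0_1; [unfold Rdiv; ring|].
exists (Z.of_nat m); now rewrite <- INR_IZR_INZ.
Qed.

Lemma cos_half_odd M : cos (INR (2 * M + 1) * (PI * (1 / 2))) = 0.
Proof.
apply cos_eq_0_1; exists (Z.of_nat M).
rewrite <- INR_IZR_INZ, plus_INR, mult_INR; simpl (INR 2); simpl (INR 1); field.
Qed.

(* Adding [cos ((2M+1) pi t) / ((2M+1) sin (pi t))] cancels the Dirichlet kernel
   in the derivative, and leaves a derivative of order [1/M]. *)
Lemma fourier_rem_1_bound s t M : 0 < s ->
  (forall x, Rmin (1 / 2) t <= x <= Rmax (1 / 2) t -> s <= sin (PI * x)) ->
  Rabs (t - 1 / 2) <= 1 / 2 ->
  Rabs (fourier_rem 1 M t) <= (PI / s ^ 2 + / s) / INR (2 * M + 1).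
Proof.
intros Hs Hx Ht.
set (q := INR (2 * M + 1)).
assert (Hq : 0 < q) by (apply lt_0_INR; lia).
pose proof PI_RGT_0 as Hpi.
set (K := fun x => fourier_rem 1 M x + cos (q * (PI * x)) / (q * sin (PI * x))).
set (dK := fun x => - (cos (q * (PI * x)) * (PI * cos (PI * x)))
                    / (q * sin (PI * x) ^ 2)).
assert (HdK : forall x, s <= sin (PI * x) -> is_derive K x (dK x)).
{ intros x Hsx; unfold K, dK.
  evar_last; [apply (is_derive_plus (V := R_NormedModule));
    [apply fourier_rem_1_derive; lra|]|].
  - auto_derive; [apply Rmult_integral_contrapositive_currified; lra|reflexivity].
  - fold q; match goal with |- plus ?a ?b = ?c => change (a + b = c) end.
    field; lra. }
assert (HK : K (1 / 2) = 0).
{ unfold K; rewrite fourier_rem_1_half; unfold q; rewrite cos_half_odd.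
  unfold Rdiv; ring. }
assert (Hst : s <= sin (PI * t)) by (apply Hx; split; [apply Rmin_r|apply Rmax_r]).
assert (H1 : Rabs (K t - K (1 / 2)) <= (PI / (q * s ^ 2)) * Rabs (t - 1 / 2)).
{ apply derive_bound with dK; [intros; now apply HdK, Hx|].
  intros x Hxx; specialize (Hx x Hxx); unfold dK.
  assert (Hsq : s ^ 2 <= sin (PI * x) ^ 2) by (apply pow_incr; lra).
  assert (Hs2 : 0 < s ^ 2) by (apply pow_lt, Hs).
  unfold Rdiv; rewrite Rabs_mult, Rabs_Ropp, !Rabs_mult, (Rabs_pos_eq PI) by lra.
  rewrite Rabs_inv, (Rabs_pos_eq (q * _))
    by (apply Rmult_le_pos; [lra|apply pow2_ge_0]).
  apply Rmult_le_compat.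
  - apply Rmult_le_pos; [apply Rabs_pos|apply Rmult_le_pos; [lra|apply Rabs_pos]].
  - left; apply Rinv_0_lt_compat, Rmult_lt_0_compat; lra.
  - transitivity (1 * (PI * 1)); [|lra].
    apply Rmult_le_compat;
      [apply Rabs_pos|apply Rmult_le_pos; [lra|apply Rabs_pos]| |].
    + apply Rabs_le, COS_bound.
    + apply Rmult_le_compat_l; [lra|apply Rabs_le, COS_bound].
  - apply Rinv_le_contravar; [now apply Rmult_lt_0_compat|].
    apply Rmult_le_compat_l; lra. }
rewrite HK, Rminus_0_r in H1.
assert (H2 : Rabs (cos (q * (PI * t)) / (q * sin (PI * t))) <= / (q * s)).
{ unfold Rdiv; rewrite Rabs_mult, Rabs_inv, (Rabs_pos_eq (q * _))
    by (apply Rmult_le_pos; lra).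
  rewrite <- (Rmult_1_l (/ (q * s))).
  apply Rmult_le_compat; [apply Rabs_pos| |apply Rabs_le, COS_bound|].
  - left; apply Rinv_0_lt_compat, Rmult_lt_0_compat; lra.
  - apply Rinv_le_contravar; [now apply Rmult_lt_0_compat|].
    apply Rmult_le_compat_l; lra. }
assert (H3 : 0 < PI / (q * s ^ 2))
  by (apply Rdiv_lt_0_compat; [lra|apply Rmult_lt_0_compat, pow_lt; lra]).
replace (fourier_rem 1 M t)
  with (K t + - (cos (q * (PI * t)) / (q * sin (PI * t)))) by (unfold K; ring).
eapply Rle_trans; [apply Rabs_triang|rewrite Rabs_Ropp].
replace ((PI / s ^ 2 + / s) / q) with (PI / (q * s ^ 2) + / (q * s)) by (field; lra).
apply Rplus_le_compat; [|exact H2].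
eapply Rle_trans; [exact H1|].
rewrite <- (Rmult_1_r (PI / _)) at 2; apply Rmult_le_compat_l; lra.
Qed.

(** [sin (pi x)] decreases away from 1/2, so its minimum between 1/2 and [t] is at [t]; this
    supplies the lower bound [s] of the order 1 estimate. *)
Lemma sin_PI_ge t x : 0 < t < 1 -> Rmin (1 / 2) t <= x <= Rmax (1 / 2) t ->
  sin (PI * t) <= sin (PI * x).
Proof.
intros Ht Hx; pose proof PI_RGT_0 as Hpi.
destruct (Rle_dec t (1 / 2)) as [H|H].
- rewrite Rmin_right, Rmax_left in Hx by lra.
  apply sin_incr_1; nra.
- rewrite Rmin_left, Rmax_right in Hx by lra.
  apply sin_decr_1; nra.
Qed.

Lemma is_lim_seq_inv_affine (a b c : R) : 0 < a ->
  is_lim_seq (fun N => c / (a * INR N + b)) 0.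
Proof.
intros Ha.
assert (E : Rbar_mult a p_infty = p_infty).
{ simpl; case Rle_dec; [|lra]; intros H; case Rle_lt_or_eq_dec; [easy|lra]. }
assert (H : is_lim_seq (fun N => a * INR N + b) p_infty).
{ apply is_lim_seq_plus with p_infty b; [|apply is_lim_seq_const|reflexivity].
  rewrite <- E; apply is_lim_seq_scal_l, is_lim_seq_INR. }
apply is_lim_seq_inv in H; [|easy].
apply (is_lim_seq_scal_l _ c) in H; simpl Rbar_mult in H.
now rewrite Rmult_0_r in H.
Qed.

Lemma is_lim_seq_squeeze_0 (u v : nat -> R) :
  (forall n, Rabs (u n) <= v n) -> is_lim_seq v 0 -> is_lim_seq u 0.
Proof.
intros H Hv; apply is_lim_seq_abs_0.
apply is_lim_seq_le_le with (fun _ => 0) v; [|apply is_lim_seq_const|exact Hv].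
intros n; split; [apply Rabs_pos|apply H].
Qed.

Lemma fourier_rem_1_lim t : 0 < t < 1 -> is_lim_seq (fun M => fourier_rem 1 M t) 0.
Proof.
intros Ht; pose proof PI_RGT_0.
assert (Hs : 0 < sin (PI * t)) by (apply sin_gt_0; nra).
apply is_lim_seq_squeeze_0 with
  (fun M => (PI / sin (PI * t) ^ 2 + / sin (PI * t)) / (2 * INR M + 1)).
- intros M; evar_last; [apply (fourier_rem_1_bound (sin (PI * t)) t M Hs)|].
  + intros x; now apply sin_PI_ge.
  + apply Rabs_le; lra.
  + now rewrite plus_INR, mult_INR.
- apply is_lim_seq_inv_affine; lra.
Qed.

(** Applies the mean value bound to the order 1 estimate between 1/2 and [t]. The constant blows up
    at the endpoints, so this limit is only pointwise. *)
Lemma fourier_rem_2_diff_lim t : 0 < t < 1 ->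
  is_lim_seq (fun M => fourier_rem 2 M t - fourier_rem 2 M (1 / 2)) 0.
Proof.
intros Ht; pose proof PI_RGT_0.
assert (Hs : 0 < sin (PI * t)) by (apply sin_gt_0; nra).
apply is_lim_seq_squeeze_0 with
  (fun M => (2 * PI * (PI / sin (PI * t) ^ 2 + / sin (PI * t))
             * Rabs (t - 1 / 2)) / (2 * INR M + 1)).
- intros M; evar_last.
  + apply derive_bound with (df := fun x => 2 * PI * fourier_rem 1 M x)
      (C := 2 * PI * ((PI / sin (PI * t) ^ 2 + / sin (PI * t)) / INR (2 * M + 1)));
      [intros; apply fourier_rem_derive|].
    intros x Hx; rewrite Rabs_mult, Rabs_pos_eq by lra.
    apply Rmult_le_compat_l; [lra|].
    apply (fourier_rem_1_bound (sin (PI * t)) x M Hs).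
    * intros y Hy; apply sin_PI_ge; [easy|].
      revert Hx Hy; unfold Rmin, Rmax; repeat case Rle_dec; lra.
    * revert Hx; unfold Rmin, Rmax; repeat case Rle_dec; intros; apply Rabs_le; lra.
  + rewrite plus_INR, mult_INR; simpl (INR 2); simpl (INR 1); field.
    pose proof (pos_INR M); split; lra.
- apply is_lim_seq_inv_affine; lra.
Qed.

(** Telescoping: [1/(n+1)^2 <= 1/n - 1/(n+1)]. *)
Lemma sum1_inv_square_tail (f : nat -> R) M N : (1 <= M <= N)%nat ->
  (forall m, (1 <= m)%nat -> Rabs (f m) <= / INR m ^ 2) ->
  Rabs (sum1 f N - sum1 f M) <= / INR M - / INR N.
Proof.
intros [HM HMN] Hf; induction HMN as [|N HN IH].
- rewrite !Rminus_diag, Rabs_R0; lra.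
- rewrite sum1_S.
  replace (sum1 f N + f (S N) - sum1 f M)
    with ((sum1 f N - sum1 f M) + f (S N)) by ring.
  eapply Rle_trans; [apply Rabs_triang|].
  assert (H : / INR (S N) ^ 2 <= / INR N - / INR (S N)).
  { assert (0 < INR N) by (apply lt_0_INR; lia).
    rewrite S_INR; apply Rminus_le.
    replace (/ (INR N + 1) ^ 2 - (/ INR N - / (INR N + 1)))
      with (- / (INR N * (INR N + 1) ^ 2)) by (field; lra).
    apply Rge_le, Ropp_0_le_ge_contravar; left; apply Rinv_0_lt_compat.
    apply Rmult_lt_0_compat, pow_lt; lra. }
  specialize (Hf (S N)); specialize (Hf ltac:(lia)); lra.
Qed.

Lemma fourier_rem_2_tail t M N : (1 <= M <= N)%nat ->
  Rabs (fourier_rem 2 N t - fourier_rem 2 M t) <= / INR M.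
Proof.
intros HMN; unfold fourier_rem.
match goal with |- Rabs (?a + ?b - (?c + ?b)) <= _ =>
  replace (a + b - (c + b)) with (a - c) by ring end.
eapply Rle_trans; [apply sum1_inv_square_tail; [exact HMN|]|].
- intros m Hm.
  assert (H : 0 < INR m ^ 2) by (apply pow_lt, lt_0_INR; lia).
  unfold Rdiv; rewrite Rabs_mult, Rabs_inv, (Rabs_pos_eq (_ ^ 2)) by lra.
  rewrite <- (Rmult_1_l (/ INR m ^ 2)) at 2; apply Rmult_le_compat_r;
    [now left; apply Rinv_0_lt_compat|apply Rabs_le, COS_bound].
- assert (0 < / INR N) by (apply Rinv_0_lt_compat, lt_0_INR; lia); lra.
Qed.

(** Pointwise convergence becomes a uniform bound: compare [M] with a larger [N], at the cost of a
    tail [1/M] at each of [t] and 1/2, then let [N] tend to infinity. *)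
Lemma fourier_rem_2_half t M : (1 <= M)%nat -> 0 < t < 1 ->
  Rabs (fourier_rem 2 M t - fourier_rem 2 M (1 / 2)) <= 2 / INR M.
Proof.
intros HM Ht.
assert (H : Rbar_le (Rabs (fourier_rem 2 M t - fourier_rem 2 M (1 / 2)))
              (2 / INR M + 0)); [|simpl in H; lra].
apply is_lim_seq_le_loc with
  (fun _ => Rabs (fourier_rem 2 M t - fourier_rem 2 M (1 / 2)))
  (fun N => 2 / INR M + Rabs (fourier_rem 2 N t - fourier_rem 2 N (1 / 2))).
- exists M; intros N HN.
  pose proof (fourier_rem_2_tail t M N (conj HM HN)) as H1.
  pose proof (fourier_rem_2_tail (1 / 2) M N (conj HM HN)) as H2.
  replace (fourier_rem 2 M t - fourier_rem 2 M (1 / 2))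
    with (- (fourier_rem 2 N t - fourier_rem 2 M t)
          + (fourier_rem 2 N (1 / 2) - fourier_rem 2 M (1 / 2))
          + (fourier_rem 2 N t - fourier_rem 2 N (1 / 2))) by ring.
  eapply Rle_trans; [apply Rabs_triang|apply Rplus_le_compat_r].
  eapply Rle_trans; [apply Rabs_triang|rewrite Rabs_Ropp; lra].
- apply is_lim_seq_const.
- apply is_lim_seq_plus'; [apply is_lim_seq_const|].
  rewrite <- Rabs_R0; apply (is_lim_seq_abs _ 0), fourier_rem_2_diff_lim, Ht.
Qed.

(** Each order is anchored at its Rolle zero [c]. At order 2, [t] and [c] are both compared with
    1/2, whence [4 = 2 + 2]; each later order costs a factor [2 pi], as [t] and [c] are at distance
    at most 1. *)
Lemma fourier_rem_bound_open n M t : (1 <= M)%nat -> 0 < t < 1 ->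
  Rabs (fourier_rem (S (S n)) M t) <= (2 * PI) ^ n * (4 / INR M).
Proof.
intros HM; pose proof PI_RGT_0; revert t.
induction n as [|n IH]; intros t Ht.
- destruct (fourier_rem_zero 1 M) as [c [Hc E]].
  pose proof (fourier_rem_2_half t M HM Ht) as H1.
  pose proof (fourier_rem_2_half c M HM Hc) as H2.
  rewrite E in H2; simpl pow.
  replace (fourier_rem 2 M t) with
    (fourier_rem 2 M t - fourier_rem 2 M (1 / 2)
     + - (0 - fourier_rem 2 M (1 / 2))) by ring.
  eapply Rle_trans; [apply Rabs_triang|rewrite Rabs_Ropp; lra].
- destruct (fourier_rem_zero (S (S n)) M) as [c [Hc E]].
  assert (H1 : Rabs (fourier_rem (S (S (S n))) M t - fourier_rem (S (S (S n))) M c)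
    <= (2 * PI) ^ S n * (4 / INR M) * Rabs (t - c)).
  { apply derive_bound with (fun x => 2 * PI * fourier_rem (S (S n)) M x);
      [intros; apply fourier_rem_derive|].
    intros x Hx; rewrite Rabs_mult, Rabs_pos_eq by lra; simpl pow.
    rewrite (Rmult_assoc (2 * PI) (_ ^ n)); apply Rmult_le_compat_l; [lra|].
    apply IH; revert Hx; unfold Rmin, Rmax; case Rle_dec; lra. }
  rewrite E, Rminus_0_r in H1.
  eapply Rle_trans; [exact H1|].
  rewrite <- (Rmult_1_r ((2 * PI) ^ S n * _)) at 2; apply Rmult_le_compat_l.
  + apply Rmult_le_pos; [apply pow_le; lra|].
    apply Rmult_le_pos; [lra|].
    left; apply Rinv_0_lt_compat, lt_0_INR; lia.
  + apply Rabs_le; lra.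
Qed.

Lemma fourier_rem_lim n t : 0 <= t < 1 ->
  is_lim_seq (fun M => fourier_rem (S (S n)) M t) 0.
Proof.
intros Ht; pose proof PI_RGT_0.
apply is_lim_seq_incr_1.
apply is_lim_seq_squeeze_0 with (fun M => ((2 * PI) ^ n * 4) / (1 * INR M + 1));
  [|apply is_lim_seq_inv_affine; lra].
intros M.
replace ((2 * PI) ^ n * 4 / (1 * INR M + 1)) with ((2 * PI) ^ n * (4 / INR (S M)))
  by (rewrite S_INR; field; pose proof (pos_INR M); lra).
destruct (Req_dec t 0) as [->|Hn]; [|apply fourier_rem_bound_open; [lia|lra]].
(* The endpoint 0 is reached by continuity, along the points [1/(k+2)] of the open interval. *)
apply (is_lim_seq_le (fun k => Rabs (fourier_rem (S (S n)) (S M) (1 / (1 * INR k + 2))))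
         (fun _ => (2 * PI) ^ n * (4 / INR (S M)))
         (Rabs (fourier_rem (S (S n)) (S M) 0)) ((2 * PI) ^ n * (4 / INR (S M)))).
- intros k; apply fourier_rem_bound_open; [lia|].
  pose proof (pos_INR k); split; [apply Rdiv_lt_0_compat; lra|].
  apply Rmult_lt_reg_r with (1 * INR k + 2); [lra|].
  unfold Rdiv; rewrite Rmult_assoc, Rinv_l; lra.
- apply (is_lim_seq_abs _ (fourier_rem (S (S n)) (S M) 0)).
  apply is_lim_seq_continuous; [|apply is_lim_seq_inv_affine; lra].
  apply continuity_pt_filterlim, (@ex_derive_continuous R_AbsRing R_NormedModule).
  eexists; apply fourier_rem_derive.
- apply is_lim_seq_const.
Qed.

(** * Zeta values and signs *)

Lemma cos_minus_INR_PI x k : cos (x - INR k * PI) = (-1) ^ k * cos x.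
Proof.
induction k as [|k IH]; [simpl; rewrite Rmult_0_l, Rminus_0_r; ring|].
rewrite S_INR; simpl pow; rewrite Rmult_assoc, <- IH.
replace (x - INR k * PI) with (x - (INR k + 1) * PI + PI) by ring.
rewrite neg_cos; ring.
Qed.

Lemma pow_m1_sqr k : (-1) ^ k * (-1) ^ k = 1.
Proof. rewrite <- Rpow_mult_distr, <- (pow1 k); f_equal; ring. Qed.

Lemma fourier_rem_even k M t :
  fourier_rem (2 * k) M t
  = (-1) ^ k * sum1 (fun m => cos (2 * PI * INR m * t) / INR m ^ (2 * k)) M
    + (2 * PI) ^ (2 * k) / (2 * INR (fact (2 * k))) * bernoulli_poly (2 * k) t.
Proof.
unfold fourier_rem; rewrite <- sum1_scal; f_equal; apply sum1_ext; intros m _.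
replace (INR (2 * k) * (PI / 2)) with (INR k * PI)
  by (rewrite mult_INR; simpl (INR 2); field).
rewrite cos_minus_INR_PI; unfold Rdiv; ring.
Qed.

Lemma fourier_rem_even_lim k t : (1 <= k)%nat -> 0 <= t < 1 ->
  is_lim_seq (fun M => fourier_rem (2 * k) M t) 0.
Proof.
intros Hk Ht; replace (2 * k)%nat with (S (S (2 * (k - 1)))) by lia.
apply fourier_rem_lim, Ht.
Qed.

(** Euler's formula for [zeta(2k)]: at [t = 0] every cosine of the series equals 1. *)
Lemma zeta_even_lim k : (1 <= k)%nat ->
  is_lim_seq (fun M => sum1 (fun m => / INR m ^ (2 * k)) M)
    (- (-1) ^ k * ((2 * PI) ^ (2 * k) / (2 * INR (fact (2 * k))))
     * bernoulli_poly (2 * k) 0).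
Proof.
intros Hk.
set (c := (2 * PI) ^ (2 * k) / (2 * INR (fact (2 * k))) * bernoulli_poly (2 * k) 0).
replace (- _ * _ * _) with ((-1) ^ k * (0 - c)) by (unfold c; ring).
apply is_lim_seq_ext with (fun M => (-1) ^ k * (fourier_rem (2 * k) M 0 - c)).
- intros M; rewrite fourier_rem_even; fold c.
  unfold Rminus; rewrite Rplus_assoc, Rplus_opp_r, Rplus_0_r, <- Rmult_assoc,
    pow_m1_sqr, Rmult_1_l.
  apply sum1_ext; intros m _; rewrite Rmult_0_r, cos_0; apply Rmult_1_l.
- apply (is_lim_seq_scal_l _ _ (0 - c)).
  apply is_lim_seq_minus'; [|apply is_lim_seq_const].
  apply fourier_rem_even_lim; [exact Hk|lra].
Qed.

(** For odd order every term of the series vanishes at 0, so the remainder there is a fixed nonzero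
    multiple of [b_n], independent of [M]; but it tends to 0. The index starts at 3 because
    [b_1 = -1/2]. *)
Lemma bernoulli_poly_odd k : bernoulli_poly (2 * k + 3) 0 = 0.
Proof.
set (n := (2 * k + 3)%nat).
set (c := (2 * PI) ^ n / (2 * INR (fact n))).
assert (Hc : c <> 0).
{ unfold c; apply Rmult_integral_contrapositive_currified.
  - apply pow_nonzero; pose proof PI_RGT_0; lra.
  - apply Rinv_neq_0_compat, Rmult_integral_contrapositive_currified;
      [lra|apply INR_fact_neq_0]. }
assert (H : is_lim_seq (fun M => fourier_rem n M 0) 0).
{ unfold n; replace (2 * k + 3)%nat with (S (S (2 * k + 1))) by lia.
  apply fourier_rem_lim; lra. }
apply is_lim_seq_ext with (v := fun _ => c * bernoulli_poly n 0) in H.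
- pose proof (is_lim_seq_unique _ _ H) as E.
  rewrite Lim_seq_const in E; injection E as E.
  apply Rmult_integral in E; tauto.
- intros M; unfold fourier_rem; fold c.
  rewrite (sum1_ext _ (fun _ => 0)); [rewrite sum1_const; ring|].
  intros m _; rewrite Rmult_0_r.
  replace (0 - INR n * (PI / 2)) with (- (PI / 2 - - INR (k + 1) * PI)).
  + rewrite cos_neg, cos_shift, sin_eq_0_1; [unfold Rdiv; ring|].
    exists (- Z.of_nat (k + 1))%Z; now rewrite opp_IZR, <- INR_IZR_INZ.
  + unfold n; rewrite !plus_INR, mult_INR; simpl (INR 2); simpl (INR 1).
    simpl (INR 3); field.
Qed.

(** Up to a positive factor, the quantity is the sum of the nonnegative terms
    [(1 - cos (2 pi m t)) / m^(2k)]. *)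
Lemma bernoulli_poly_even_sign k t : (1 <= k)%nat -> 0 < t < 1 ->
  0 < (-1) ^ k * (bernoulli_poly (2 * k) t - bernoulli_poly (2 * k) 0).
Proof.
intros Hk Ht; pose proof PI_RGT_0 as Hpi.
set (c := (2 * PI) ^ (2 * k) / (2 * INR (fact (2 * k)))).
assert (Hc : 0 < c).
{ apply Rdiv_lt_0_compat; [apply pow_lt; lra|].
  apply Rmult_lt_0_compat; [lra|apply INR_fact_lt_0]. }
set (d := bernoulli_poly (2 * k) t - bernoulli_poly (2 * k) 0).
assert (H1 : cos (2 * PI * t) < 1).
{ replace (2 * PI * t) with (2 * (PI * t)) by ring; rewrite cos_2a_sin.
  assert (0 < sin (PI * t)) by (apply sin_gt_0; nra); nra. }
(* The term [m = 1] is a positive lower bound for all partial sums, which makes the conclusion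
   strict. *)
assert (H : Rbar_le (1 - cos (2 * PI * t)) ((-1) ^ k * (c * d))).
{ apply is_lim_seq_le_loc with
    (fun _ => 1 - cos (2 * PI * t))
    (fun M => (-1) ^ k * (c * d)
              + (-1) ^ k * (fourier_rem (2 * k) M 0 - fourier_rem (2 * k) M t)).
  - exists 1%nat; intros M HM.
    transitivity (sum1 (fun m => (1 - cos (2 * PI * INR m * t)) / INR m ^ (2 * k)) M).
    + destruct M as [|M]; [lia|]; rewrite sum1_first.
      simpl (INR 1); rewrite pow1, Rdiv_1_r, Rmult_1_r.
      rewrite <- (Rplus_0_r (1 - _)) at 1; apply Rplus_le_compat_l.
      replace 0 with (INR M * 0) by ring; rewrite <- sum1_const; apply sum1_le.
      intros m _; apply Rmult_le_pos.
      * pose proof (COS_bound (2 * PI * INR (S m) * t)); lra.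
      * left; apply Rinv_0_lt_compat, pow_lt, lt_0_INR; lia.
    + right; rewrite !fourier_rem_even; fold c.
      transitivity ((-1) ^ k * (-1) ^ k *
        (sum1 (fun m => cos (2 * PI * INR m * 0) / INR m ^ (2 * k)) M
         - sum1 (fun m => cos (2 * PI * INR m * t) / INR m ^ (2 * k)) M));
        [|unfold d; ring].
      rewrite pow_m1_sqr, Rmult_1_l; unfold Rminus at 2.
      replace (- sum1 _ M) with
        (-1 * sum1 (fun m => cos (2 * PI * INR m * t) / INR m ^ (2 * k)) M) by ring.
      rewrite <- sum1_scal, <- sum1_plus; apply sum1_ext; intros m _.
      rewrite Rmult_0_r, cos_0; unfold Rdiv; ring.
  - apply is_lim_seq_const.
  - replace (Finite ((-1) ^ k * (c * d)))
      with (Finite ((-1) ^ k * (c * d) + (-1) ^ k * (0 - 0))) by (f_equal; ring).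
    apply is_lim_seq_plus'; [apply is_lim_seq_const|].
    apply (is_lim_seq_scal_l _ _ (0 - 0)).
    apply is_lim_seq_minus'; apply fourier_rem_even_lim; trivial; lra. }
simpl in H.
apply Rmult_lt_reg_l with c; [exact Hc|]; lra.
Qed.

(** * Enveloping expansion of the harmonic numbers *)

Definition harmonic (n : nat) : R := sum1 (fun k => / INR k) n.

Lemma harmonic_S n : harmonic (S n) = harmonic n + / INR (S n).
Proof. apply sum1_S. Qed.

Lemma inv_pow_derive b n x t : 0 < x + t ->
  is_derive (fun t => b / (INR (S n) * (x + t) ^ S n)) t (- b / (x + t) ^ S (S n)).
Proof.
intros Hx.
assert (Hn : INR (S n) <> 0) by (apply not_0_INR; lia).
assert (Hp : (x + t) ^ n <> 0) by (apply pow_nonzero; lra).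
auto_derive.
- apply Rmult_integral_contrapositive_currified; [exact Hn|].
  apply (pow_nonzero (x + t) (S n)); lra.
- change (match n with O => 1 | S _ => INR n + 1 end) with (INR (S n)).
  change (pred (S n)) with n; simpl pow; field; repeat split; trivial; lra.
Qed.

(** Euler-Maclaurin in differential form: the derivative of the [i]-th term is
    [B_{i-1}/(x+t)^i - B_i/(x+t)^(i+1)], so the sum telescopes against [1/(x+t)], the derivative of
    the logarithm. *)
Lemma stirling_sum_derive n x t : 0 < x + t ->
  is_derive (fun t => ln (x + t)
               - sum1 (fun i => bernoulli_poly i t / (INR i * (x + t) ^ i)) n) t
    (bernoulli_poly n t / (x + t) ^ S n).
Proof.
intros Hx; induction n as [|n IH].
- apply is_derive_ext with (fun t => ln (x + t));
    [intros u; now rewrite sum1_0, Rminus_0_r|].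
  auto_derive; [exact Hx|simpl; field; lra].
- assert (Hn : INR (S n) <> 0) by (apply not_0_INR; lia).
  assert (Hp : (x + t) ^ n <> 0) by (apply pow_nonzero; lra).
  apply is_derive_ext with (fun t => ln (x + t)
      - sum1 (fun i => bernoulli_poly i t / (INR i * (x + t) ^ i)) n
      + - (bernoulli_poly (S n) t * / (INR (S n) * (x + t) ^ S n)));
    [intros u; rewrite sum1_S; apply Rminus_diag_uniq; unfold Rdiv; ring|].
  evar_last.
  + apply (is_derive_plus (V := R_NormedModule)); [exact IH|].
    apply (is_derive_opp (V := R_NormedModule)).
    apply (is_derive_mult (bernoulli_poly (S n)) (fun t => / (INR (S n) * (x + t) ^ S n)));
      [apply bernoulli_poly_derive| |intros; apply Rmult_comm].
    auto_derive; [|reflexivity].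
    apply Rmult_integral_contrapositive_currified; [exact Hn|].
    apply (pow_nonzero (x + t) (S n)); lra.
  + match goal with |- plus ?a (opp (plus (mult ?b ?c) (mult ?d ?e))) = ?f =>
      change (a + - (b * c + d * e) = f) end.
    change (match n with O => 1 | S _ => INR n + 1 end) with (INR (S n)).
    change (pred (S n)) with n; simpl pow; field; repeat split; trivial; lra.
Qed.

(* The expansion of [H_x - gamma], written with all the Bernoulli numbers: the
   index [1] accounts for [1/(2x)], the other odd indices contribute nothing. *)
Definition harmonic_approx (n : nat) (x : R) : R :=
  ln x - sum1 (fun i => bernoulli_poly i 0 / (INR i * x ^ i)) n.

Lemma harmonic_approx_odd k x :
  harmonic_approx (2 * k + 3) x = harmonic_approx (2 * k + 2) x.
Proof.
unfold harmonic_approx; replace (2 * k + 3)%nat with (S (2 * k + 2)) by lia.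
rewrite sum1_S; replace (S (2 * k + 2)) with (2 * k + 3)%nat by lia.
rewrite bernoulli_poly_odd; unfold Rdiv; ring.
Qed.

(** Adding [b/(n (x+t)^n)] to the function of [stirling_sum_derive] replaces [B_n] by [B_n - b] in
    its derivative, which then has constant sign. Between 0 and 1 that extra term cancels the top
    term of the sum, [B_i] agrees at both ends for [i >= 2], and the jump of [B_1] from -1/2 to 1/2
    produces [1/(x+1)]. *)
Lemma harmonic_approx_step k x : 0 < x ->
  0 < (-1) ^ S k * (harmonic_approx (2 * k + 1) (x + 1)
                    - harmonic_approx (2 * k + 1) x - / (x + 1)).
Proof.
intros Hx.
set (n := (2 * S k)%nat); set (b := bernoulli_poly n 0).
set (L := fun t => ln (x + t)
               - sum1 (fun i => bernoulli_poly i t / (INR i * (x + t) ^ i)) n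
               + b / (INR n * (x + t) ^ n)).
assert (Hn : INR n <> 0) by (apply not_0_INR; lia).
destruct (MVT_derive L (fun t => (bernoulli_poly n t - b) / (x + t) ^ S n) 0 1)
  as [c [Hc E]]; [lra| |].
- intros t Ht; unfold L.
  evar_last.
  + apply (is_derive_plus (V := R_NormedModule)); [apply stirling_sum_derive; lra|].
    replace n with (S (2 * k + 1)) by lia; apply inv_pow_derive; lra.
  + match goal with |- plus ?a ?b = ?c => change (a + b = c) end.
    replace (S (S (2 * k + 1))) with (S n) by lia.
    unfold Rdiv; ring.
- replace (harmonic_approx (2 * k + 1) (x + 1) - harmonic_approx (2 * k + 1) x
           - / (x + 1)) with (L 1 - L 0).
  + rewrite E, Rminus_0_r, Rmult_1_r; unfold Rdiv; rewrite <- Rmult_assoc.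
    apply Rmult_lt_0_compat; [apply bernoulli_poly_even_sign; [lia|exact Hc]|].
    apply Rinv_0_lt_compat, pow_lt; lra.
  + unfold L, harmonic_approx; rewrite Rplus_0_r.
    replace n with (S (2 * k + 1)) in * by lia.
    rewrite !sum1_S; fold b.
    replace (2 * k + 1)%nat with (S (2 * k)) by lia.
    rewrite !(sum1_first _ (2 * k)).
    replace (S (S (2 * k))) with n by lia.
    assert (Eb : bernoulli_poly n 1 = b)
      by (unfold b, n; replace (2 * S k)%nat with (S (S (2 * k))) by lia;
          apply bernoulli_poly_periodic).
    rewrite Eb, !bernoulli_poly_1.
    rewrite (sum1_ext (fun i => bernoulli_poly (S i) 1 / (INR (S i) * (x + 1) ^ S i))
              (fun i => bernoulli_poly (S i) 0 / (INR (S i) * (x + 1) ^ S i))).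
    * simpl (INR 1); rewrite !pow_1; unfold Rdiv; rewrite !Rmult_1_l.
      change (bernoulli_poly n 0) with b; ring.
    * intros [|i] Hi; [lia|]; now rewrite bernoulli_poly_periodic.
Qed.

Lemma is_lim_seq_inv_pow c i : (1 <= i)%nat ->
  is_lim_seq (fun m => c / (INR i * INR m ^ i)) 0.
Proof.
intros Hi; apply is_lim_seq_incr_1.
assert (H1 : 1 <= INR i) by (apply (le_INR 1); lia).
apply is_lim_seq_squeeze_0 with (fun m => Rabs c / (1 * INR m + 1));
  [|apply is_lim_seq_inv_affine; lra].
intros m.
assert (H2 : 1 <= INR (S m)) by (apply (le_INR 1); lia).
assert (H3 : INR (S m) <= INR (S m) ^ i)
  by (rewrite <- (pow_1 (INR (S m))) at 1; apply Rle_pow; assumption).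
unfold Rdiv; rewrite Rabs_mult, Rabs_inv, (Rabs_pos_eq (_ * _)) by nra.
apply Rmult_le_compat_l; [apply Rabs_pos|].
rewrite Rmult_1_l, <- S_INR; apply Rinv_le_contravar; nra.
Qed.

Lemma harmonic_approx_incr k m : (1 <= m)%nat ->
  (-1) ^ k * (harmonic m - harmonic_approx (2 * k + 1) (INR m))
  < (-1) ^ k * (harmonic (S m) - harmonic_approx (2 * k + 1) (INR (S m))).
Proof.
intros Hm.
pose proof (harmonic_approx_step k (INR m)) as H.
rewrite harmonic_S, S_INR; simpl pow in H.
specialize (H ltac:(apply lt_0_INR; lia)); lra.
Qed.

Lemma harmonic_approx_lim n :
  is_lim_seq (fun m => ln (INR m) - harmonic_approx n (INR m)) 0.
Proof.
replace 0 with (sum1 (fun _ => 0) n) by (rewrite sum1_const; ring).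
apply is_lim_seq_ext with (fun m =>
  sum1 (fun i => bernoulli_poly i 0 / (INR i * INR m ^ i)) n).
- intros m; unfold harmonic_approx; ring.
- apply (is_lim_seq_sum1 (fun i m => bernoulli_poly i 0 / (INR i * INR m ^ i))).
  intros i Hi; apply is_lim_seq_inv_pow; lia.
Qed.

(** [Lim_seq] asserts no convergence, so it has to be proved. The errors of the expansions for
    [k = 0] and [k = 1] are increasing and decreasing respectively and differ by [b_2/(2m^2)]; the
    first is therefore bounded, hence convergent. *)
Lemma euler_gamma_lim : is_lim_seq (fun n => harmonic n - ln (INR n)) euler_gamma.
Proof.
apply Lim_seq_correct'.
set (e := fun k m => harmonic (S m) - harmonic_approx (2 * k + 1) (INR (S m))).
assert (Hb : ex_finite_lim_seq (e 0%nat)).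
{ apply ex_finite_lim_seq_incr with (e 1%nat 0%nat + Rabs (bernoulli_poly 2 0)).
  - intros m; pose proof (harmonic_approx_incr 0 (S m)) as H; unfold e.
    simpl pow in H; specialize (H ltac:(lia)); lra.
  - intros m.
    assert (H1 : e 1%nat m <= e 1%nat 0%nat).
    { induction m as [|m IH]; [lra|].
      pose proof (harmonic_approx_incr 1 (S m)) as H; unfold e in *.
      simpl pow in H; specialize (H ltac:(lia)); lra. }
    assert (H2 : e 0%nat m = e 1%nat m - bernoulli_poly 2 0 / (2 * INR (S m) ^ 2)).
    { unfold e; change (2 * 1 + 1)%nat with (2 * 0 + 3)%nat.
      rewrite harmonic_approx_odd; unfold harmonic_approx.
      change (2 * 0 + 2)%nat with 2%nat; rewrite (sum1_S _ 1).
      change (2 * 0 + 1)%nat with 1%nat; change (INR 2) with 2; ring. }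
    assert (H3 : 1 <= INR (S m)) by (apply (le_INR 1); lia).
    assert (H4 : Rabs (bernoulli_poly 2 0 / (2 * INR (S m) ^ 2))
                 <= Rabs (bernoulli_poly 2 0)).
    { unfold Rdiv; rewrite Rabs_mult, Rabs_inv, (Rabs_pos_eq (_ * _)) by nra.
      rewrite <- (Rmult_1_r (Rabs _)) at 2.
      apply Rmult_le_compat_l; [apply Rabs_pos|].
      rewrite <- Rinv_1; apply Rinv_le_contravar; nra. }
    rewrite <- Rabs_Ropp in H4.
    pose proof (Rle_abs (- (bernoulli_poly 2 0 / (2 * INR (S m) ^ 2)))); lra. }
destruct Hb as [l Hl]; exists l.
apply is_lim_seq_ext with (fun n =>
  (harmonic n - harmonic_approx 1 (INR n)) - (ln (INR n) - harmonic_approx 1 (INR n)));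
  [intros n; unfold harmonic; simpl; unfold sum1; ring|].
replace l with (l - 0) by ring.
apply is_lim_seq_minus'; [|apply harmonic_approx_lim].
apply is_lim_seq_incr_1; exact Hl.
Qed.

(** The error of the expansion is strictly monotone in [m], in the direction given by [(-1)^k], and
    tends to gamma. *)
Lemma harmonic_approx_enveloping k m : (1 <= m)%nat ->
  0 < (-1) ^ k * (euler_gamma - (harmonic m - harmonic_approx (2 * k + 1) (INR m))).
Proof.
intros Hm.
set (u := fun m => (-1) ^ k * (harmonic (S m) - harmonic_approx (2 * k + 1) (INR (S m)))).
assert (Hu : is_lim_seq u ((-1) ^ k * euler_gamma)).
{ apply (is_lim_seq_scal_l _ _ euler_gamma).
  apply (is_lim_seq_incr_1 (fun m =>
    harmonic m - harmonic_approx (2 * k + 1) (INR m))).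
  apply is_lim_seq_ext with (fun n => (harmonic n - ln (INR n))
    + (ln (INR n) - harmonic_approx (2 * k + 1) (INR n))); [intros; ring|].
  rewrite <- (Rplus_0_r euler_gamma).
  apply is_lim_seq_plus'; [apply euler_gamma_lim|apply harmonic_approx_lim]. }
assert (H := is_lim_seq_incr_compare u _ Hu).
assert (H' : forall n, u n <= u (S n))
  by (intros n; left; apply harmonic_approx_incr; lia).
specialize (H H' m).
(* [u m] is the value at [m + 1]; the strict step from [m] to [m + 1] gives the strict
   inequality. *)
pose proof (harmonic_approx_incr k m Hm) as H1.
unfold u in H; lra.
Qed.

Definition harmonic_error (m : nat) : R :=
  harmonic m - ln (INR m) - euler_gamma - / (2 * INR m).

Lemma harmonic_approx_even_terms k x : x <> 0 ->
  harmonic_approx (2 * k + 1) x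
  = ln x + / (2 * x)
    - sum1 (fun j => bernoulli_poly (2 * j) 0 / (INR (2 * j) * x ^ (2 * j))) k.
Proof.
intros Hx; induction k as [|k IH].
- unfold harmonic_approx; simpl (2 * 0 + 1)%nat.
  rewrite sum1_S, !sum1_0, bernoulli_poly_1; simpl; field; exact Hx.
- replace (2 * S k + 1)%nat with (2 * k + 3)%nat by lia.
  rewrite harmonic_approx_odd, sum1_S.
  unfold harmonic_approx in *; replace (2 * k + 2)%nat with (S (2 * k + 1)) by lia.
  rewrite sum1_S; replace (S (2 * k + 1)) with (2 * S k)%nat by lia.
  lra.
Qed.

Lemma harmonic_error_enveloping k m : (1 <= m)%nat ->
  0 < (-1) ^ S k * (harmonic_error m
    + sum1 (fun j => bernoulli_poly (2 * j) 0 / (INR (2 * j) * INR m ^ (2 * j))) k).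
Proof.
intros Hm; pose proof (harmonic_approx_enveloping k m Hm) as H.
rewrite harmonic_approx_even_terms in H by (apply not_0_INR; lia).
eapply Rlt_le_trans; [exact H|right].
unfold harmonic_error; simpl pow; ring.
Qed.

Lemma harmonic_error_bound m : (1 <= m)%nat ->
  Rabs (harmonic_error m) <= bernoulli_poly 2 0 / (2 * INR m ^ 2).
Proof.
intros Hm.
pose proof (harmonic_error_enveloping 0 m Hm) as H0.
pose proof (harmonic_error_enveloping 1 m Hm) as H1.
rewrite sum1_0 in H0; rewrite sum1_S, sum1_0 in H1.
change (2 * 1)%nat with 2%nat in H1; change (INR 2) with 2 in H1.
simpl ((-1) ^ _) in H0, H1.
rewrite Rabs_left by lra; lra.
Qed.

(** * The cotangent sum as a limit of harmonic sums *)

Lemma sin_ratio_neq_0 p i : (1 <= i < p)%nat -> sin (PI * (INR i / INR p)) <> 0.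
Proof.
intros Hi; pose proof PI_RGT_0.
assert (0 < INR i < INR p) by (split; [apply lt_0_INR|apply lt_INR]; lia).
assert (0 < INR i / INR p) by (apply Rdiv_lt_0_compat; lra).
assert (INR i / INR p < 1) by (apply Rmult_lt_reg_r with (INR p);
  [lra|unfold Rdiv; rewrite Rmult_assoc, Rinv_l; lra]).
apply Rgt_not_eq, sin_gt_0; nra.
Qed.

(** The Dirichlet kernel at [t = i/p] with [p - 1] terms: [sin ((2p-1) pi i/p) = - sin (pi i/p)]. *)
Lemma sum_cos_multiples p i : (1 <= i < p)%nat ->
  sum1 (fun k => cos (2 * PI * INR i * (INR k / INR p))) (p - 1) = -1.
Proof.
intros Hi.
assert (Hs := sin_ratio_neq_0 p i Hi).
assert (Hp : INR p <> 0) by (apply not_0_INR; lia).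
pose proof (dirichlet_kernel (INR i / INR p) (p - 1)) as H.
replace (INR (2 * (p - 1) + 1) * (PI * (INR i / INR p)))
  with (- (PI * (INR i / INR p)) + 2 * INR i * PI) in H.
- rewrite sin_period, sin_neg in H.
  rewrite (sum1_ext _ (fun m => cos (2 * PI * INR m * (INR i / INR p)))).
  + apply Rmult_eq_reg_r with (sin (PI * (INR i / INR p))); lra.
  + intros k _; f_equal; field; exact Hp.
- replace (INR (2 * (p - 1) + 1)) with (2 * INR p - 1); [field; exact Hp|].
  rewrite plus_INR, mult_INR, minus_INR by lia; simpl (INR 2); simpl (INR 1); ring.
Qed.

Definition sin_cot_sum (p m : nat) : R :=
  sum1 (fun k => sin (2 * PI * INR m * (INR k / INR p)) * cot (INR k * PI / INR p))
    (p - 1).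

Lemma sin_cot_sum_0 p : sin_cot_sum p 0 = 0.
Proof.
unfold sin_cot_sum; rewrite (sum1_ext _ (fun _ => 0)); [rewrite sum1_const; ring|].
intros k _; simpl (INR 0); rewrite Rmult_0_r, Rmult_0_l, sin_0; ring.
Qed.

(** Termwise, [(sin (y+2x) - sin y) cot x = 2 cos (y+x) cos x = cos y + cos (y+2x)]. *)
Lemma sin_cot_sum_S p m :
  sin_cot_sum p (S m) = sin_cot_sum p m
   + sum1 (fun k => cos (2 * PI * INR m * (INR k / INR p))) (p - 1)
   + sum1 (fun k => cos (2 * PI * INR (S m) * (INR k / INR p))) (p - 1).
Proof.
unfold sin_cot_sum; rewrite <- !sum1_plus; apply sum1_ext; intros k Hk.
assert (Hs := sin_ratio_neq_0 p k ltac:(lia)).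
unfold cot; replace (INR k * PI / INR p) with (PI * (INR k / INR p))
  by (unfold Rdiv; ring).
set (x := PI * (INR k / INR p)) in *.
replace (2 * PI * INR (S m) * (INR k / INR p)) with (2 * PI * INR m * (INR k / INR p) + 2 * x)
  by (unfold x; rewrite S_INR; ring).
set (y := 2 * PI * INR m * (INR k / INR p)).
rewrite sin_plus, cos_plus, sin_2a, cos_2a_sin.
pose proof (sin2_cos2 x) as E; unfold Rsqr in E.
apply Rmult_eq_reg_r with (sin x); [|exact Hs].
field_simplify; [|exact Hs|exact Hs].
replace (cos x ^ 2) with (1 - sin x ^ 2) by (rewrite <- E; ring); ring.
Qed.

Lemma sin_cot_sum_small p i : (1 <= i < p)%nat ->
  sin_cot_sum p i = INR p - 2 * INR i.
Proof.
intros [H1 H2]; induction H1 as [|i H1 IH].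
- rewrite sin_cot_sum_S, sin_cot_sum_0, (sum_cos_multiples p 1) by lia.
  rewrite (sum1_ext _ (fun _ => 1)).
  + rewrite sum1_const, minus_INR by lia; simpl (INR 1); ring.
  + intros k _; simpl (INR 0); rewrite Rmult_0_r, Rmult_0_l; apply cos_0.
- rewrite sin_cot_sum_S, IH, !sum_cos_multiples, S_INR by lia; ring.
Qed.

Lemma sin_cot_sum_periodic p j i : (1 <= p)%nat ->
  sin_cot_sum p (j * p + i) = sin_cot_sum p i.
Proof.
intros Hp; apply sum1_ext; intros k _; f_equal.
rewrite <- (sin_period (2 * PI * INR i * (INR k / INR p)) (j * k)); f_equal.
rewrite plus_INR, !mult_INR; field; apply not_0_INR; lia.
Qed.

(** At [m = jp + i] the sawtooth value [p - 2i] equals [(2j+1)p - 2m], so its quotient by [m] is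
    [(2j+1)p/m - 2]. *)
Lemma sin_cot_sum_block p j i : (i < p)%nat ->
  sum1 (fun m => sin_cot_sum p m / INR m) (j * p + i)
  = sum1 (fun m => sin_cot_sum p m / INR m) (j * p)
    + INR (2 * j + 1) * INR p * (harmonic (j * p + i) - harmonic (j * p)) - 2 * INR i.
Proof.
induction i as [|i IH]; intros Hi; [rewrite Nat.add_0_r; simpl (INR 0); ring|].
replace (j * p + S i)%nat with (S (j * p + i)) by lia.
rewrite sum1_S, IH, harmonic_S by lia.
replace (S (j * p + i)) with (j * p + S i)%nat by lia.
rewrite sin_cot_sum_periodic, sin_cot_sum_small by lia.
assert (H : INR (j * p + S i) <> 0) by (apply not_0_INR; lia).
replace (INR p - 2 * INR (S i))
  with (INR (2 * j + 1) * INR p - 2 * INR (j * p + S i)).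
- rewrite (S_INR i); field; exact H.
- rewrite !plus_INR, !mult_INR; simpl (INR 2); simpl (INR 1); ring.
Qed.

(** Summation by parts over the blocks. At [m = (j+1)p] the block formula would contribute
    [-1/(j+1)] where the true term is 0; these corrections add up to [harmonic N]. *)
Lemma sin_cot_sum_total p N : (1 <= p)%nat ->
  sum1 (fun m => sin_cot_sum p m / INR m) (N * p)
  = harmonic N - 2 * INR N * INR p
    + INR p * (INR (2 * N + 1) * harmonic (N * p)
               - 2 * sum1 (fun m => harmonic (m * p)) N).
Proof.
intros Hp; induction N as [|N IH].
- unfold harmonic; simpl (0 * p)%nat; rewrite !sum1_0; simpl; ring.
- pose proof (sin_cot_sum_block p N (p - 1) ltac:(lia)) as H.
  replace (S N * p)%nat with (S (N * p + (p - 1))) by lia.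
  rewrite sum1_S, H, IH, sum1_S, !harmonic_S.
  replace (S (N * p + (p - 1))) with (S N * p + 0)%nat by lia.
  rewrite sin_cot_sum_periodic, sin_cot_sum_0 by lia.
  replace (harmonic (N * p + (p - 1))) with (harmonic (S N * p) - / INR (S N * p)).
  + rewrite minus_INR, Nat.add_0_r, !plus_INR, !mult_INR, !S_INR by lia.
    simpl (INR 0).
    assert (INR p <> 0) by (apply not_0_INR; lia).
    pose proof (pos_INR N); field; split; lra.
  + replace (S N * p)%nat with (S (N * p + (p - 1))) by lia.
    rewrite harmonic_S; ring.
Qed.

Lemma sum_cot p : sum1 (fun k => cot (INR k * PI / INR p)) (p - 1) = 0.
Proof.
set (f := fun k => cot (INR k * PI / INR p)).
assert (H : sum1 f (p - 1) = -1 * sum1 f (p - 1)); [|lra].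
rewrite <- (sum1_rev f) at 1; rewrite <- sum1_scal; apply sum1_ext; intros k Hk.
assert (Hp : INR p <> 0) by (apply not_0_INR; lia).
unfold f, cot; replace (S (p - 1) - k)%nat with (p - k)%nat by lia.
replace (INR (p - k) * PI / INR p) with (PI - INR k * PI / INR p)
  by (rewrite minus_INR by lia; field; exact Hp).
rewrite sin_PI_x, Rtrigo_facts.cos_pi_minus; unfold Rdiv; ring.
Qed.

(** Each [k/p] lies in (0,1), so pointwise convergence at order 1 suffices for the finite sum over
    [k]; the constant in [k/p - 1/2] disappears because the cotangents sum to 0. *)
Lemma cot_sum_lim p : (1 <= p)%nat ->
  is_lim_seq (fun N => 2 * INR N * INR p - harmonic N
    - INR p * (INR (2 * N + 1) * harmonic (N * p))
    + 2 * INR p * sum1 (fun m => harmonic (m * p)) N) (PI * cot_sum p / INR p).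
Proof.
intros Hp.
assert (Hp0 : INR p <> 0) by (apply not_0_INR; lia).
set (c := PI * cot_sum p / INR p).
assert (H : is_lim_seq (fun N => sum1 (fun k =>
    cot (INR k * PI / INR p) * fourier_rem 1 (N * p) (INR k / INR p)) (p - 1)) 0).
{ replace 0 with (sum1 (fun _ => 0) (p - 1)) by (rewrite sum1_const; ring).
  apply (is_lim_seq_sum1 (fun k N => cot (INR k * PI / INR p)
           * fourier_rem 1 (N * p) (INR k / INR p))).
  intros k Hk.
  rewrite <- (Rmult_0_r (cot (INR k * PI / INR p))).
  apply (is_lim_seq_scal_l _ _ 0).
  apply (is_lim_seq_subseq (fun M => fourier_rem 1 M (INR k / INR p)) 0
           (fun N => (N * p)%nat)).
  - apply eventually_subseq; intros n; nia.
  - apply fourier_rem_1_lim.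
    assert (0 < INR k < INR p) by (split; [apply lt_0_INR|apply lt_INR]; lia).
    split; [apply Rdiv_lt_0_compat; lra|].
    apply Rmult_lt_reg_r with (INR p); [lra|].
    unfold Rdiv; rewrite Rmult_assoc, Rinv_l; lra. }
replace (Finite c) with (Finite (c - 0)) by (f_equal; ring).
eapply is_lim_seq_ext; [|apply is_lim_seq_minus'; [apply is_lim_seq_const|exact H]].
intros N; cbv beta.
transitivity (- sum1 (fun m => sin_cot_sum p m / INR m) (N * p));
  [|rewrite sin_cot_sum_total by exact Hp; ring].
assert (E : forall k, cot (INR k * PI / INR p) * fourier_rem 1 (N * p) (INR k / INR p)
  = sum1 (fun m => sin (2 * PI * INR m * (INR k / INR p)) * cot (INR k * PI / INR p)
                   / INR m) (N * p)
    + (PI / INR p * (INR k * cot (INR k * PI / INR p))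
    + - (PI / 2) * cot (INR k * PI / INR p))).
{ intros k; unfold fourier_rem; rewrite bernoulli_poly_1, Rmult_plus_distr_l, <- sum1_scal.
  f_equal; [|simpl; field; exact Hp0].
  apply sum1_ext; intros m Hm; simpl (INR 1).
  rewrite Rmult_1_l, <- cos_neg, Ropp_minus_distr, cos_shift, pow_1.
  unfold Rdiv; ring. }
rewrite (sum1_ext _ _ _ (fun k _ => E k)).
rewrite !sum1_plus, !sum1_scal, sum_cot, sum1_swap.
rewrite (sum1_ext (fun m => sin_cot_sum p m / INR m)
  (fun m => sum1 (fun k => sin (2 * PI * INR m * (INR k / INR p))
     * cot (INR k * PI / INR p) / INR m) (p - 1))).
- unfold c; change (cot_sum p) with (sum1 (fun k => INR k * cot (INR k * PI / INR p)) (p - 1)).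
  unfold Rdiv; ring.
- intros m _; unfold sin_cot_sum, Rdiv; rewrite Rmult_comm, <- sum1_scal.
  apply sum1_ext; intros k _; ring.
Qed.

(** * Wallis and Stirling *)

Definition wallis (n : nat) : R := RInt (fun x => sin x ^ n) 0 (PI / 2).

Lemma ex_RInt_sin_pow n a b : ex_RInt (fun x => sin x ^ n) a b.
Proof.
apply (@ex_RInt_continuous R_CompleteNormedModule); intros z _.
apply (@ex_derive_continuous R_AbsRing R_NormedModule); auto_derive; trivial.
Qed.

Lemma wallis_0 : wallis 0 = PI / 2.
Proof.
unfold wallis; simpl pow; rewrite RInt_const.
unfold scal; simpl; unfold mult; simpl; field.
Qed.

Lemma wallis_1 : wallis 1 = 1.
Proof.
apply is_RInt_unique.
replace 1 with (minus (- cos (PI / 2)) (- cos 0))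
  by (rewrite cos_PI2, cos_0; unfold minus, plus, opp; simpl; ring).
apply (is_RInt_derive (fun x => - cos x)).
- intros x _; auto_derive; [trivial|ring].
- intros x _; apply (@ex_derive_continuous R_AbsRing R_NormedModule).
  auto_derive; trivial.
Qed.

(** Integrates the derivative of [- cos x * sin x ^ (n+1)], which vanishes at both ends. *)
Lemma wallis_rec n : INR (S (S n)) * wallis (S (S n)) = INR (S n) * wallis n.
Proof.
set (f := fun x => - (cos x * sin x ^ S n)).
assert (H1 : is_RInt (fun x => INR (S (S n)) * sin x ^ S (S n) - INR (S n) * sin x ^ n)
               0 (PI / 2) (minus (f (PI / 2)) (f 0))).
{ apply (is_RInt_derive f).
  - intros x _; unfold f; evar_last; [auto_derive; [trivial|reflexivity]|].
    change (match n with O => 1 | S _ => INR n + 1 end) with (INR (S n)).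
    change (match S n with O => 1 | S _ => INR (S n) + 1 end) with (INR (S (S n))).
    change (pred (S n)) with n; rewrite (S_INR (S n)).
    pose proof (sin2_cos2 x) as E; unfold Rsqr in E.
    transitivity (sin x ^ S (S n) - INR (S n) * sin x ^ n * (cos x * cos x));
      [simpl pow; ring|].
    replace (cos x * cos x) with (1 - sin x * sin x) by (rewrite <- E; ring).
    simpl pow; ring.
  - intros x _; apply (@ex_derive_continuous R_AbsRing R_NormedModule).
    auto_derive; trivial. }
assert (H2 : is_RInt (fun x => INR (S (S n)) * sin x ^ S (S n) - INR (S n) * sin x ^ n)
               0 (PI / 2) (INR (S (S n)) * wallis (S (S n)) - INR (S n) * wallis n)).
{ apply (is_RInt_minus (V := R_NormedModule));
    apply (is_RInt_scal (V := R_NormedModule));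
    apply (@RInt_correct R_CompleteNormedModule), ex_RInt_sin_pow. }
apply (@is_RInt_unique R_CompleteNormedModule) in H1.
apply (@is_RInt_unique R_CompleteNormedModule) in H2.
rewrite H1 in H2; unfold f, minus, plus, opp in H2; simpl in H2.
rewrite cos_PI2, sin_0 in H2; simpl in *; lra.
Qed.

Lemma wallis_decr n : wallis (S n) <= wallis n.
Proof.
pose proof PI_RGT_0.
apply RInt_le; [lra|apply ex_RInt_sin_pow|apply ex_RInt_sin_pow|].
intros x Hx; simpl.
assert (0 <= sin x) by (apply sin_ge_0; lra).
pose proof (SIN_bound x); pose proof (pow_le (sin x) n ltac:(lra)); nra.
Qed.

Lemma wallis_prod n : INR (S n) * wallis n * wallis (S n) = PI / 2.
Proof.
induction n as [|n IH]; [rewrite wallis_0, wallis_1; simpl; ring|].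
rewrite <- IH; transitivity (wallis (S n) * (INR (S (S n)) * wallis (S (S n)))); [ring|].
rewrite wallis_rec; ring.
Qed.

Lemma wallis_even n :
  wallis (2 * n) = PI / 2 * INR (fact (2 * n)) / (2 ^ n * INR (fact n)) ^ 2.
Proof.
induction n as [|n IH]; [change (2 * 0)%nat with 0%nat; rewrite wallis_0; simpl; field|].
pose proof (wallis_rec (2 * n)) as H; rewrite IH in H.
replace (S (S (2 * n))) with (2 * S n)%nat in H by lia.
apply Rmult_eq_reg_l with (INR (2 * S n)); [|apply not_0_INR; lia].
rewrite H; replace (fact (2 * S n)) with ((2 * S n) * (S (2 * n) * fact (2 * n)))%nat.
- rewrite (fact_simpl n), !mult_INR, !S_INR, !mult_INR, !S_INR; change (INR 0) with 0.
  simpl pow.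
  pose proof (pos_INR n); pose proof (INR_fact_neq_0 n).
  assert (2 ^ n <> 0) by (apply pow_nonzero; lra).
  field; repeat split; trivial; lra.
- replace (2 * S n)%nat with (S (S (2 * n))) by lia; rewrite !fact_simpl; ring.
Qed.

(** Logarithm of [n! e^n / n^(n+1/2)]. *)
Definition stirling_seq (n : nat) : R :=
  ln (INR (fact n)) - (INR n + / 2) * ln (INR n) + INR n.

(** The midpoint bound for the integral of [1/u] over [[x, x+1]]: with a variable length [t], the
    difference of both sides has derivative [t^2] over a positive quantity. The trapezoid bound
    below has the same proof. *)
Lemma ln_step_lower x : 0 < x -> / (x + / 2) < ln (x + 1) - ln x.
Proof.
intros Hx.
set (g := fun t => ln (x + t) - ln x - 2 * t / (2 * x + t)).
destruct (MVT_derive g (fun t => t ^ 2 / ((x + t) * (2 * x + t) ^ 2)) 0 1)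
  as [c [Hc E]]; [lra| |].
- intros t Ht; unfold g; auto_derive; [repeat split; lra|field; lra].
- assert (0 < c ^ 2 / ((x + c) * (2 * x + c) ^ 2)).
  { apply Rdiv_lt_0_compat; [apply pow_lt; lra|].
    apply Rmult_lt_0_compat; [|apply pow_lt]; lra. }
  unfold g in E; rewrite Rplus_0_r in E.
  replace (/ (x + / 2)) with (2 * 1 / (2 * x + 1)) by (field; lra).
  unfold Rdiv in E at 2; rewrite Rmult_0_r, Rmult_0_l in E; lra.
Qed.

Lemma ln_step_upper x : 0 < x -> ln (x + 1) - ln x < (/ x + / (x + 1)) / 2.
Proof.
intros Hx.
set (g := fun t => (/ x + / (x + t)) * t / 2 - (ln (x + t) - ln x)).
destruct (MVT_derive g (fun t => t ^ 2 / (2 * x * (x + t) ^ 2)) 0 1)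
  as [c [Hc E]]; [lra| |].
- intros t Ht; unfold g; auto_derive; [repeat split; lra|field; lra].
- assert (0 < c ^ 2 / (2 * x * (x + c) ^ 2)).
  { apply Rdiv_lt_0_compat; [apply pow_lt; lra|].
    apply Rmult_lt_0_compat; [|apply pow_lt]; lra. }
  unfold g in E; rewrite Rplus_0_r in E; lra.
Qed.

Lemma stirling_seq_step n : (1 <= n)%nat ->
  stirling_seq n - stirling_seq (S n)
  = (INR n + / 2) * (ln (INR n + 1) - ln (INR n)) - 1.
Proof.
intros Hn; unfold stirling_seq; rewrite fact_simpl, mult_INR, ln_mult, S_INR.
- ring.
- apply lt_0_INR; lia.
- apply INR_fact_lt_0.
Qed.

Lemma stirling_seq_cv : ex_finite_lim_seq stirling_seq.
Proof.
assert (Hpos : forall m, 0 < INR (S m)) by (intros; apply lt_0_INR; lia).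
assert (Hlow : forall m, 1 < (INR (S m) + / 2) * (ln (INR (S m) + 1) - ln (INR (S m)))).
{ intros m; specialize (Hpos m); pose proof (ln_step_lower _ Hpos) as H.
  apply Rmult_lt_compat_l with (r := INR (S m) + / 2) in H; [|lra].
  rewrite Rinv_r in H; lra. }
assert (H : ex_finite_lim_seq (fun m => stirling_seq (S m))).
{ apply ex_finite_lim_seq_decr with (stirling_seq 1 - / 4).
  - intros m; pose proof (stirling_seq_step (S m) ltac:(lia)); specialize (Hlow m); lra.
  - intros m.
    (* The correction comes from [(x+1/2)(1/x + 1/(x+1))/2 = 1 + 1/(4x) - 1/(4(x+1))]: the trapezoid
       bound makes [stirling_seq n - 1/(4n)] increasing. *)
    assert (H1 : stirling_seq 1 - / (4 * INR 1)
                 <= stirling_seq (S m) - / (4 * INR (S m))).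
    { induction m as [|m IH]; [lra|].
      pose proof (stirling_seq_step (S m) ltac:(lia)) as Hs.
      specialize (Hpos m); pose proof (ln_step_upper _ Hpos) as H.
      rewrite (S_INR (S m)).
      set (x := INR (S m)) in *.
      apply Rmult_lt_compat_l with (r := x + / 2) in H; [|lra].
      replace ((x + / 2) * ((/ x + / (x + 1)) / 2))
        with (1 + / (4 * x) - / (4 * (x + 1))) in H by (field; lra).
      lra. }
    assert (0 < / (4 * INR (S m)))
      by (apply Rinv_0_lt_compat; specialize (Hpos m); lra).
    simpl (INR 1) in H1; rewrite Rmult_1_r in H1; lra. }
destruct H as [l Hl]; exists l; now apply is_lim_seq_incr_1 in Hl.
Qed.

Lemma wallis_even_ln n : (1 <= n)%nat ->
  ln (wallis (2 * n))
  = ln (PI / 2) + stirling_seq (2 * n) - 2 * stirling_seq n + ln 2 / 2 - ln (INR n) / 2.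
Proof.
intros Hn; rewrite wallis_even.
assert (0 < INR n) by (apply lt_0_INR; lia).
pose proof PI_RGT_0; pose proof (INR_fact_lt_0 n); pose proof (INR_fact_lt_0 (2 * n)).
assert (0 < 2 ^ n) by (apply pow_lt; lra).
assert (0 < 2 ^ n * INR (fact n)) by (now apply Rmult_lt_0_compat).
rewrite ln_div, ln_mult, ln_pow, ln_mult, ln_pow;
  try lra; try (apply Rmult_lt_0_compat; lra); try (now apply pow_lt).
unfold stirling_seq; rewrite mult_INR; simpl (INR 2).
rewrite ln_mult by lra; change (1 + 1) with 2; field.
Qed.

Lemma stirling_seq_lim : is_lim_seq stirling_seq (ln (2 * PI) / 2).
Proof.
destruct stirling_seq_cv as [l Hl].
pose proof PI_RGT_0 as Hpi.
(* This combination is the logarithm of [2n W^2 / (pi/2)] for [W = wallis (2n)], which Wallis's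
   product sends to 0; a limit [l] must then satisfy [ln (2 pi) = 2 l]. *)
assert (H0 : is_lim_seq
  (fun n => ln (2 * PI) + 2 * (stirling_seq (2 * n) - 2 * stirling_seq n)) 0).
{ apply is_lim_seq_incr_1, is_lim_seq_squeeze_0 with (fun n => 1 / (1 * INR n + 1));
    [|apply is_lim_seq_inv_affine; lra].
  intros m; replace (1 / (1 * INR m + 1)) with (/ INR (S m))
    by (rewrite S_INR; pose proof (pos_INR m); field; lra).
  pose proof (wallis_even_ln (S m) ltac:(lia)) as E.
  assert (Hw : 0 < wallis (2 * S m)).
  { rewrite wallis_even; apply Rdiv_lt_0_compat.
    - apply Rmult_lt_0_compat; [lra|apply INR_fact_lt_0].
    - apply pow_lt, Rmult_lt_0_compat; [apply pow_lt; lra|apply INR_fact_lt_0]. }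
  pose proof (wallis_prod (2 * S m)) as Hp.
  pose proof (wallis_decr (2 * S m)) as H1.
  pose proof (wallis_decr (S (2 * S m))) as H2.
  pose proof (wallis_rec (2 * S m)) as H3.
  rewrite !S_INR, mult_INR in H3; rewrite S_INR, mult_INR in Hp.
  change (INR 2) with 2 in *.
  assert (Hx : 0 < INR (S m)) by (apply lt_0_INR; lia).
  set (x := INR (S m)) in *; set (w := wallis (2 * S m)) in *.
  set (w1 := wallis (S (2 * S m))) in *.
  set (w2 := wallis (S (S (2 * S m)))) in *.
  pose proof (ln_step_upper x Hx) as Hs.
  assert (Hs' : ln (x + 1) - ln x <= / x).
  { assert (/ (x + 1) <= / x) by (apply Rinv_le_contravar; lra); lra. }
  assert (E2 : ln (PI / 2) + 2 * ln 2 = ln (2 * PI)).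
  { replace (2 * PI) with (PI / 2 * 2 * 2) by field.
    rewrite !ln_mult by lra; ring. }
  assert (Hl2 : ln (2 * x) = ln 2 + ln x) by (apply ln_mult; lra).
  assert (Hl3 : ln (2 * x + 2) = ln 2 + ln (x + 1))
    by (rewrite <- ln_mult by lra; f_equal; ring).
  assert (Hl4 : ln (2 * x) <= ln (2 * x + 1)) by (apply ln_le; lra).
  assert (Hl5 : ln (2 * x + 1) <= ln (2 * x + 2)) by (apply ln_le; lra).
  assert (U : ln (PI / 2) <= ln (2 * x + 1) + 2 * ln w).
  { replace (ln (2 * x + 1) + 2 * ln w) with (ln ((2 * x + 1) * w * w))
      by (rewrite !ln_mult by nra; ring).
    apply ln_le; [lra|]; rewrite <- Hp; apply Rmult_le_compat_l; nra. }
  assert (L : 2 * ln (2 * x + 1) - ln (2 * x + 2) + 2 * ln w <= ln (PI / 2)).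
  { assert (Hw2 : w2 = (2 * x + 1) * w / (2 * x + 2)).
    { apply Rmult_eq_reg_l with (2 * x + 2); [|lra].
      replace (2 * x + 2) with (2 * x + 1 + 1) at 1 by ring.
      rewrite H3; field; lra. }
    replace (2 * ln (2 * x + 1) - ln (2 * x + 2) + 2 * ln w)
      with (ln ((2 * x + 1) * w * ((2 * x + 1) * w / (2 * x + 2)))).
    - rewrite <- Hw2; apply ln_le; [|rewrite <- Hp; apply Rmult_le_compat_l; nra].
      assert (0 < w2) by (rewrite Hw2; apply Rdiv_lt_0_compat; nra).
      apply Rmult_lt_0_compat; nra.
    - rewrite ln_mult, ln_div, !ln_mult; try nra. }
  apply Rabs_le; lra. }
assert (Hl' : is_lim_seq
  (fun n => ln (2 * PI) + 2 * (stirling_seq (2 * n) - 2 * stirling_seq n))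
  (ln (2 * PI) + 2 * (l - 2 * l))).
{ apply is_lim_seq_plus'; [apply is_lim_seq_const|].
  apply (is_lim_seq_scal_l _ _ (l - 2 * l)), is_lim_seq_minus'.
  - apply (is_lim_seq_subseq stirling_seq l (fun n => (2 * n)%nat)); [|exact Hl].
    apply eventually_subseq; intros n; lia.
  - apply (is_lim_seq_scal_l _ _ l), Hl. }
apply is_lim_seq_unique in H0; apply is_lim_seq_unique in Hl'.
rewrite H0 in Hl'; injection Hl' as E.
replace (ln (2 * PI) / 2) with l by lra; exact Hl.
Qed.

(** * Enveloping of the cotangent sum *)

Lemma sum1_ln N : sum1 (fun m => ln (INR m)) N = ln (INR (fact N)).
Proof.
induction N as [|N IH]; [rewrite sum1_0; simpl; now rewrite ln_1|].
rewrite sum1_S, IH, fact_simpl, mult_INR, ln_mult.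
- ring.
- apply lt_0_INR; lia.
- apply INR_fact_lt_0.
Qed.

(** Exact at finite [N]: the logarithms from the sum and those from [(2N+1) H_{Np}] combine with
    [ln N!] into [stirling_seq N], and the last parenthesis tends to 0. *)
Lemma harmonic_error_sum p N : (1 <= p)%nat -> (1 <= N)%nat ->
  2 * INR p * sum1 (fun m => harmonic_error (m * p)) N
  = 2 * INR N * INR p - harmonic N - INR p * (INR (2 * N + 1) * harmonic (N * p))
    + 2 * INR p * sum1 (fun m => harmonic (m * p)) N
    - (2 * INR p * stirling_seq N
       - INR p * ln (INR p) - INR p * euler_gamma - 1)
    + (1 / 2 / INR N + INR p * (INR (2 * N + 1) * harmonic_error (N * p))).
Proof.
intros Hp HN.
assert (Hp0 : 0 < INR p) by (apply lt_0_INR; lia).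
assert (HN0 : 0 < INR N) by (apply lt_0_INR; lia).
rewrite (sum1_ext (fun m => harmonic_error (m * p)) (fun m =>
  harmonic (m * p) + (-1 * ln (INR m) + (- (ln (INR p) + euler_gamma)
    + - / (2 * INR p) * / INR m)))).
- rewrite !sum1_plus, !sum1_scal, sum1_const, sum1_ln.
  change (sum1 (fun k => / INR k) N) with (harmonic N).
  unfold harmonic_error, stirling_seq.
  rewrite plus_INR, !mult_INR, ln_mult by assumption.
  simpl (INR 2); simpl (INR 1); field; lra.
- intros m Hm; unfold harmonic_error.
  assert (Hm0 : 0 < INR m) by (apply lt_0_INR; lia).
  rewrite mult_INR, ln_mult by assumption; field; lra.
Qed.

(** The error is of order [1/N^2], against a factor linear in [N]; [3/2] comes from [2x + 1 <= 3x]
    and the bound [b/(2x^2)]. *)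
Lemma harmonic_error_mult_lim p : (1 <= p)%nat ->
  is_lim_seq (fun N => INR (2 * N + 1) * harmonic_error (N * p)) 0.
Proof.
intros Hp; apply is_lim_seq_incr_1.
set (b := bernoulli_poly 2 0).
apply is_lim_seq_squeeze_0 with (fun N => (3 / 2 * b) / (1 * INR N + 1));
  [|apply is_lim_seq_inv_affine; lra].
intros N.
pose proof (harmonic_error_bound (S N * p) ltac:(nia)) as H; fold b in H.
assert (Hp0 : 1 <= INR p) by (apply (le_INR 1); lia).
assert (HN0 : 1 <= INR (S N)) by (apply (le_INR 1); lia).
rewrite Rmult_1_l, <- S_INR, Rabs_mult, Rabs_pos_eq by apply pos_INR.
rewrite mult_INR in H; rewrite plus_INR, mult_INR.
change (INR 2) with 2; change (INR 1) with 1.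
set (x := INR (S N)) in *; set (q := INR p) in *.
(* A negative [b] would make the bound on an absolute value negative. *)
assert (Hb : 0 <= b).
{ destruct (Rle_lt_dec 0 b) as [|Hb]; [easy|exfalso].
  assert (b / (2 * (x * q) ^ 2) < 0).
  { apply Rdiv_neg_pos; [exact Hb|]; apply Rmult_lt_0_compat; [lra|].
    apply pow_lt; nra. }
  pose proof (Rabs_pos (harmonic_error (S N * p))); lra. }
transitivity (3 * x * (b / (2 * x ^ 2))); [|right; field; lra].
apply Rmult_le_compat; [lra|apply Rabs_pos|lra|].
eapply Rle_trans; [exact H|].
apply Rmult_le_compat_l; [exact Hb|].
apply Rinv_le_contravar; [nra|]; apply Rmult_le_compat_l; [lra|].
apply pow_incr; nra.
Qed.

Lemma harmonic_error_sum_lim p : (1 <= p)%nat ->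
  is_lim_seq (fun N => 2 * INR p * sum1 (fun m => harmonic_error (m * p)) N)
    (PI * cot_sum p / INR p
     - (INR p * ln (2 * PI) - INR p * ln (INR p) - INR p * euler_gamma - 1)).
Proof.
intros Hp.
replace (PI * cot_sum p / INR p - _) with
  (PI * cot_sum p / INR p
    - (2 * INR p * (ln (2 * PI) / 2)
       - INR p * ln (INR p) - INR p * euler_gamma - 1) + (0 + INR p * 0))
  by (field; apply not_0_INR; lia).
eapply is_lim_seq_ext_loc.
- exists 1%nat; intros N HN; symmetry; apply harmonic_error_sum; assumption.
- apply is_lim_seq_plus'; [apply is_lim_seq_minus'|].
  + now apply cot_sum_lim.
  + repeat (apply is_lim_seq_minus'; [|apply is_lim_seq_const]).
    apply (is_lim_seq_scal_l _ _ (ln (2 * PI) / 2)), stirling_seq_lim.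
  + apply is_lim_seq_plus'.
    * apply is_lim_seq_ext with (fun n => 1 / 2 / (1 * INR n + 0));
        [intros; f_equal; ring|apply is_lim_seq_inv_affine; lra].
    * now apply (is_lim_seq_scal_l _ _ 0), harmonic_error_mult_lim.
Qed.

(** Sums the enveloping inequality at [mp] over [m]. One factor [b_{2j}] comes from the expansion
    ([c j]), the other from [zeta(2j)] ([z j]); the term [m = 1] is kept for strictness. *)
Lemma cot_sum_enveloping p r : (1 <= p)%nat ->
  0 < (-1) ^ S r * (cot_sum p - cot_sum_approx bernoulli_poly p r).
Proof.
intros Hp; pose proof PI_RGT_0 as Hpi.
assert (Hp0 : 0 < INR p) by (apply lt_0_INR; lia).
set (b := fun j => bernoulli_poly (2 * j) 0).
set (z := fun j => - (-1) ^ j * ((2 * PI) ^ (2 * j) / (2 * INR (fact (2 * j)))) * b j).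
set (D := PI * cot_sum p / INR p
     - (INR p * ln (2 * PI) - INR p * ln (INR p) - INR p * euler_gamma - 1)).
set (c := fun j => b j / (INR (2 * j) * INR p ^ (2 * j))).
set (t := fun m => (-1) ^ S r * (harmonic_error (m * p)
  + sum1 (fun j => b j / (INR (2 * j) * INR (m * p) ^ (2 * j))) r)).
assert (Ht : forall m, (1 <= m)%nat -> 0 < t m)
  by (intros m Hm; apply harmonic_error_enveloping; nia).
assert (H : Rbar_le (2 * INR p * t 1%nat)
              ((-1) ^ S r * (D + 2 * INR p * sum1 (fun j => c j * z j) r))).
{ apply is_lim_seq_le_loc with (fun _ => 2 * INR p * t 1%nat)
    (fun N => 2 * INR p * sum1 t N).
  - exists 1%nat; intros [|N] HN; [lia|].
    apply Rmult_le_compat_l; [lra|]; rewrite sum1_first.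
    rewrite <- (Rplus_0_r (t 1%nat)) at 1; apply Rplus_le_compat_l.
    replace 0 with (INR N * 0) by ring; rewrite <- sum1_const; apply sum1_le.
    intros m _; left; apply Ht; lia.
  - apply is_lim_seq_const.
  - apply is_lim_seq_ext with (fun N => (-1) ^ S r *
      (2 * INR p * sum1 (fun m => harmonic_error (m * p)) N
       + 2 * INR p * sum1 (fun j => c j * sum1 (fun m => / INR m ^ (2 * j)) N) r)).
    + intros N; unfold t; rewrite sum1_scal, sum1_plus, sum1_swap.
      rewrite (sum1_ext (fun j => c j * _) (fun j => sum1 (fun m =>
        b j / (INR (2 * j) * INR (m * p) ^ (2 * j))) N)); [ring|].
      intros j Hj; rewrite <- sum1_scal; apply sum1_ext; intros m Hm.
      unfold c; rewrite (mult_INR m p), Rpow_mult_distr; field.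
      repeat split; try (apply pow_nonzero); apply not_0_INR; lia.
    + apply (is_lim_seq_scal_l _ _ (D + 2 * INR p * sum1 (fun j => c j * z j) r)).
      apply is_lim_seq_plus'; [now apply harmonic_error_sum_lim|].
      apply (is_lim_seq_scal_l _ _ (sum1 (fun j => c j * z j) r)).
      apply (is_lim_seq_sum1 (fun j N => c j * sum1 (fun m => / INR m ^ (2 * j)) N)).
      intros j Hj; apply (is_lim_seq_scal_l _ _ (z j)), zeta_even_lim; lia. }
simpl in H; specialize (Ht 1%nat ltac:(lia)).
replace ((-1) ^ S r * (cot_sum p - cot_sum_approx bernoulli_poly p r))
  with (INR p / PI * ((-1) ^ S r * (D + 2 * INR p * sum1 (fun j => c j * z j) r))).
- apply Rmult_lt_0_compat; [apply Rdiv_lt_0_compat; lra|].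
  eapply Rlt_le_trans; [|exact H]; apply Rmult_lt_0_compat; lra.
- rewrite <- (Rmult_assoc (INR p / PI)), (Rmult_comm (INR p / PI)), Rmult_assoc.
  f_equal; unfold cot_sum_approx, bernoulli_number.
  (* The scale [-p^2/pi^2] balances [(p/pi) * 2p], in front of the sum of the [c j * z j], against
     the [-2 pi] in front of the stated sum. *)
  match goal with |- context [sum_n_m ?f 1 r] =>
    change (sum_n_m f 1 r) with (sum1 f r);
    rewrite (sum1_ext f (fun j => - (INR p ^ 2 / PI ^ 2) * (c j * z j))) end.
  + rewrite sum1_scal; unfold D; field; lra.
  + intros j Hj; unfold c, z, b.
    destruct j as [|j]; [lia|].
    replace (2 * S j - 2)%nat with (2 * j)%nat by lia.
    assert (Hf := INR_fact_neq_0 (2 * S j)).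
    assert (Hj0 : INR (S j) <> 0) by (apply not_0_INR; lia).
    assert (Hp1 : INR p ^ (2 * j) <> 0) by (apply pow_nonzero; lra).
    replace (INR (2 * S j)) with (2 * INR (S j)) by (now rewrite mult_INR).
    set (F := INR (fact (2 * S j))) in *; set (x := bernoulli_poly (2 * S j) 0).
    set (s := (-1) ^ S j).
    replace (2 * S j)%nat with (2 + 2 * j)%nat by lia.
    unfold Rdiv at 2; rewrite Rpow_mult_distr, pow_inv, !pow_add.
    simpl (_ ^ 2); field; repeat split; trivial; lra.
Qed.

Theorem corollary11p8 :
  forall B : nat -> R -> R, bernoulli_polynomials B ->
  forall p n : nat, (0 < p)%nat ->
    cot_sum p < cot_sum_approx B p (2 * n) /\
    cot_sum p > cot_sum_approx B p (2 * n + 1).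
Proof.
intros B HB p n Hp.
assert (E : forall r, cot_sum_approx B p r = cot_sum_approx bernoulli_poly p r).
{ intros r; unfold cot_sum_approx, bernoulli_number; do 2 f_equal.
  apply sum_n_m_ext; intros k.
  now rewrite (bernoulli_polynomials_unique _ _ HB bernoulli_poly_spec). }
rewrite !E.
pose proof (cot_sum_enveloping p (2 * n) Hp) as H1.
pose proof (cot_sum_enveloping p (2 * n + 1) Hp) as H2.
rewrite pow_1_odd in H1.
replace (S (2 * n + 1)) with (2 * S n)%nat in H2 by lia; rewrite pow_1_even in H2.
lra.
Qed.
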